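(* Let the sequence of integers $\{a_i\}_{i=1}^{\infty}$ be defined by $$\{a_1,a_2,\dots\}=\{0,2,\overline{1,2,1,0,0,1,2,1,0,2,2,4}\},$$ where the bar indicates that the terms under it repeat infinitely often. Let $t$ be the number with regular continued fraction expansion $$t=[0,g_1+a_1,g_2+a_2,g_3+a_3,\dots],$$ where $g_i$ is the integer consisting of a tower of $i$ sixteens with an $i$ on top, i.e. $g_1=16^1=16$, $g_2=16^{16^2}$, $g_3=16^{16^{16^3}}$, and so on. If $y=\exp(2\pi i t)$, then $R(y)$ has subsequences of convergents tending to all ten values taken by the Rogers-Ramanujan continued fraction at roots of unity; that is, for each $j\in\{1,\dots,10\}$ some subsequence of $\{R_n(y)\}_{n}$ tends to $R_j$.
   Context: The tower can be described as $g_i=T_i(i)$, where $T_0(z)=z$ and $T_{j+1}(z)=16^{T_j(z)}$. $\phi=(\sqrt5+1)/2$. For $x$ on the unit circle let $K_n(x)=P_n(x)/Q_n(x)$ be the $n$-th convergent of $K(x)=1+\cfrac{x}{1+\cfrac{x^2}{1+\cfrac{x^3}{1+\ddots}}}$, where $P_0=1$, $P_1=1+x$, $Q_0=Q_1=1$, $P_{n+1}=P_n+x^{n+1}P_{n-1}$, $Q_{n+1}=Q_n+x^{n+1}Q_{n-1}$ for $n\ge 1$. The Rogers-Ramanujan continued fraction is $R(x)=x^{1/5}/K(x)$, with $n$-th convergent $R_n(x)=x^{1/5}/K_n(x)$, where for $x=\exp(2\pi i t)$, $t\in[0,1)$, one takes $x^{1/5}=\exp(2\pi i t/5)$. The ten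 values taken by $R(x)$ at roots of unity (where it converges) are $$R_j=-\phi\exp(2\pi i j/5)\ \ (1\le j\le5),\qquad R_j=\frac{\exp(2\pi i j/5)}{\phi}\ \ (6\le j\le10).$$ *)

(* Defs.v *)
From Stdlib Require Import Reals List Arith.
From Coquelicot Require Import Coquelicot.
Import ListNotations.

Open Scope R_scope.

(** [tower z j] is [T_j(z)]. *)
Fixpoint tower (z j : nat) : nat :=
  match j with
  | O => z
  | S k => Nat.pow 16 (tower z k)
  end.

Definition g (i : nat) : nat := tower i i.

Definition a_period : list nat := [1; 2; 1; 0; 0; 1; 2; 1; 0; 2; 2; 4]%nat.

(** Indexed from 1; the value at 0 is irrelevant. *)
Definition a (i : nat) : nat :=
  match i with
  | 0%nat => 0%nat
  | 1%nat => 0%nat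
  | 2%nat => 2%nat
  | S (S (S k)) => nth (k mod 12) a_period 0%nat
  end.

Definition partial_quotient (i : nat) : nat :=
  match i with
  | O => 0%nat
  | S _ => (g i + a i)%nat
  end.

(** [cf_convergent b n] is the finite continued fraction [b_0, b_1, ..., b_n]. *)
Fixpoint cf_convergent (b : nat -> nat) (n : nat) : R :=
  match n with
  | O => INR (b 0%nat)
  | S m => INR (b 0%nat) + / cf_convergent (fun i => b (S i)) m
  end.

Definition has_cf_expansion (t : R) (b : nat -> nat) : Prop :=
  is_lim_seq (cf_convergent b) t.

(** [cis u] is [exp (i u)]. *)
Definition cis (u : R) : C := (cos u, sin u).

Fixpoint P (x : C) (n : nat) : C :=
  match n with
  | O => 1%C
  | S m => match m with
           | O => (1 + x)%C
           | S k => (P x m + x ^ n * P x k)%C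
           end
  end.

Fixpoint Q (x : C) (n : nat) : C :=
  match n with
  | O => 1%C
  | S m => match m with
           | O => 1%C
           | S k => (Q x m + x ^ n * Q x k)%C
           end
  end.

Definition K_convergent (x : C) (n : nat) : C := (P x n / Q x n)%C.

(** The [n]-th convergent of [R(x)] at [x = exp (2 pi i t)].  It is a function
    of [t] because the branch [x^(1/5) = exp (2 pi i t / 5)] is fixed by
    choosing [t] in [0, 1).  With the convention [/ 0 = 0], a vanishing [Q x n]
    gives the value 0, as it does on the Riemann sphere, and a vanishing [P x n]
    gives 0 in place of infinity; so convergence to a nonzero finite limit means
    the same as on the sphere. *)
Definition R_convergent (t : R) (n : nat) : C :=
  (cis (2 * PI * t / 5) / K_convergent (cis (2 * PI * t)) n)%C.

Definition phi : R := (sqrt 5 + 1) / 2.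

(** [R_j] for [1 <= j <= 10]; other indices are irrelevant. *)
Definition R_value (j : nat) : C :=
  if (j <=? 5)%nat
  then (- RtoC phi * cis (2 * PI * INR j / 5))%C
  else (cis (2 * PI * INR j / 5) / RtoC phi)%C.

(* Main.v *)
Require Import Defs.
From Stdlib Require Import Reals Lra Lia ZArith Arith Znumtheory List.
From Coquelicot Require Import Coquelicot.

(** Let [x = exp (2 pi i c / m)] be a primitive [m]-th root of unity with [m] prime to 5.
    The proof has two halves: the value of [R] at [x] depends only on [c] and [m] modulo
    5, and [y] is so close to the roots of unity [exp (2 pi i c_n / d_n)], where
    [c_n / d_n] are the convergents of [t], that the convergents of [R(y)] imitate those at
    these roots of unity for a long time.

    Roots of unity.  [P_(n-1)] and [Q_(n-1)] solve the recurrence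
    [u_(n+2) = u_(n+1) + x^(n+1) u_n], whose coefficients have period [m], so a period
    matrix carries each solution from one block of length [m] to the next.
    Its determinant is [-1] ([period_det]).  Its trace, as a polynomial in a starting
    point [z] of degree less than [m], is invariant under [z -> z x], hence constant,
    and its constant term is 1 ([period_trace_one]).  By Cayley-Hamilton each solution
    sampled along multiples of [m] satisfies the Fibonacci recurrence
    ([period_recurrence]), so only [P_(m-1)] and [Q_(m-1)] remain to be found.
    Schur's finite form of the Rogers-Ramanujan identities writes [P_(n-1)] and
    [Q_(n-1)] as alternating sums of q-binomials [[n; floor ((n + s - 5 j) / 2)]],
    with [s = 0] and [s = 2] respectively ([schur_identity_P], [schur_identity_Q]).  At a
    primitive [m]-th root of unity all q-binomials [[m; k]] with [0 < k < m] vanish, and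
    at most one term of each sum survives for [n = m].  So [P_(m-1)] is 1 or 0 according
    to whether [m] is a square modulo 5, [Q_(m-1)] is an explicit root of unity, and
    [x^(1/5) Q_(km-1) / P_(km-1)] tends to [exp (2 pi i j / 5) / phi] or
    [- phi exp (2 pi i j / 5)], where [j m = c] modulo 5
    ([root_convergent]).

    Approximation.  Passing from [x] to [y] changes [P_(n-1)] and [Q_(n-1)] by at most
    [2 * 4^n] times the difference of the angles ([solves_perturb]), while
    [|t - c_n / d_n| <= 2 / d_(n+1)] and the towers grow so fast that
    [d_(n+1) >= 16^(d_n^2)] ([cden_sq_le]).  So the convergent of [R(y)] of index
    [d_n^2 - 1], that is, after [d_n] periods, is close to the value of [R] at
    [exp (2 pi i c_n / d_n)] ([convergent_near]).

    Residues.  Every [g_i] is 1 modulo 5, so [(c_n, d_n)] modulo 5 is determined by the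
    [a_i]; it is periodic in [n] with period 12, and one period meets all ten values
    ([residue_table]). *)

Open Scope R_scope.

(** * The unit circle and continuants *)

Lemma cis_plus (u v : R) : cis (u + v) = (cis u * cis v)%C.
Proof. unfold cis, Cmult; simpl. rewrite cos_plus, sin_plus. f_equal; ring. Qed.

Lemma cis_0 : cis 0 = 1%C.
Proof. unfold cis. now rewrite cos_0, sin_0. Qed.

Lemma Cmod_cis (u : R) : Cmod (cis u) = 1.
Proof.
unfold Cmod, cis; simpl fst; simpl snd.
replace (cos u ^ 2 + sin u ^ 2) with 1; [apply sqrt_1|].
generalize (sin2_cos2 u); unfold Rsqr; simpl; lra.
Qed.

Lemma cis_PI : cis PI = (- (1))%C.
Proof. unfold cis. rewrite cos_PI, sin_PI. unfold RtoC, Copp. simpl. f_equal; ring. Qed.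

Lemma cis_2PI_Z (k : Z) : cis (2 * PI * IZR k) = 1%C.
Proof.
assert (H2 : cis (2 * PI) = 1%C).
{ unfold cis. now rewrite cos_2PI, sin_2PI. }
induction k as [|k IH|k IH] using Z.peano_ind.
- rewrite Rmult_0_r. apply cis_0.
- rewrite succ_IZR, Rmult_plus_distr_l, cis_plus, IH, Rmult_1_r, H2. ring.
- rewrite <- IH. replace (IZR k) with (IZR (Z.pred k) + 1).
  + rewrite Rmult_plus_distr_l, cis_plus, Rmult_1_r, H2. ring.
  + rewrite <- succ_IZR. f_equal. lia.
Qed.

Lemma cis_PI_even (k : Z) : Z.Even k -> cis (PI * IZR k) = 1%C.
Proof.
intros [h ->]. rewrite mult_IZR, <- (cis_2PI_Z h). f_equal. ring.
Qed.

Lemma cis_PI_odd (k : Z) : Z.Odd k -> cis (PI * IZR k) = (- (1))%C.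
Proof.
intros [h ->]. rewrite plus_IZR, mult_IZR.
replace (PI * (2 * IZR h + 1)) with (2 * PI * IZR h + PI) by ring.
rewrite cis_plus, cis_2PI_Z, cis_PI. ring.
Qed.

Lemma cis_eq_1 (u : R) : cis u = 1%C -> exists k : Z, u = 2 * PI * IZR k.
Proof.
intros H. assert (Hs : sin u = 0) by exact (f_equal snd H).
destruct (sin_eq_0_0 u Hs) as [k Hk].
destruct (Z.Even_or_Odd k) as [Hp|Hp].
- destruct Hp as [h ->]. exists h. rewrite Hk, mult_IZR. ring.
- exfalso. assert (H1 : cis u = (- (1))%C).
  { rewrite Hk, Rmult_comm. now apply cis_PI_odd. }
  rewrite H in H1. apply (f_equal fst) in H1. simpl in H1. lra.
Qed.

(** The power [x^k] of [x = exp (i th)] with an integer exponent. *)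
Definition xpow (th : R) (k : Z) : C := cis (th * IZR k).

Lemma xpow_0 th : xpow th 0 = 1%C.
Proof. unfold xpow. rewrite Rmult_0_r. apply cis_0. Qed.

Lemma xpow_plus th a b : xpow th (a + b) = (xpow th a * xpow th b)%C.
Proof. unfold xpow. now rewrite plus_IZR, Rmult_plus_distr_l, cis_plus. Qed.

Lemma Cmod_xpow th k : Cmod (xpow th k) = 1.
Proof. apply Cmod_cis. Qed.

Lemma cis_Cpow th (n : nat) : (cis th ^ n)%C = xpow th (Z.of_nat n).
Proof.
induction n as [|n IH].
- symmetry; apply xpow_0.
- rewrite Cpow_S, IH. replace (Z.of_nat (S n)) with (1 + Z.of_nat n)%Z by lia.
  rewrite xpow_plus. unfold xpow at 2. now rewrite Rmult_1_r.
Qed.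

(** The polynomial [P_(n-1)] with [x^k] replaced by [x^(i+k)]: the top left entry of the
    product of [[1, 1; x^l, 0]] for [i <= l < i + n].  The case [i = 0] gives the
    [P_(n-1)] and [i = 1] gives the [Q_n].  A free starting point [i] is what makes the
    averaging argument for the trace possible. *)
Fixpoint continuant (th : R) (i : Z) (n : nat) : C :=
  match n with
  | O => 1%C
  | S m => match m with
           | O => 1%C
           | S k => (continuant th i m + xpow th (i + Z.of_nat m) * continuant th i k)%C
           end
  end.

Lemma continuant_SS th i n :
  continuant th i (S (S n))
  = (continuant th i (S n) + xpow th (i + Z.of_nat (S n)) * continuant th i n)%C.
Proof. reflexivity. Qed.

Lemma nat_ind2 (A : nat -> Prop) :
  A 0%nat -> A 1%nat -> (forall n, A n -> A (S n) -> A (S (S n))) -> forall n, A n.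
Proof.
intros H0 H1 HS n. enough (A n /\ A (S n)) by tauto.
induction n; intuition.
Qed.

(** A continuant expands from its left end as well as from its right end. *)
Lemma continuant_left th i n :
  continuant th i (S (S n))
  = (continuant th (i + 1) (S n) + xpow th (i + 1) * continuant th (i + 2) n)%C.
Proof.
induction n as [| |n IH0 IH1] using nat_ind2.
- simpl. reflexivity.
- rewrite !continuant_SS. simpl (continuant _ _ 1). simpl (continuant _ _ 0).
  replace (i + Z.of_nat 2)%Z with (i + 1 + Z.of_nat 1)%Z by lia.
  simpl Z.of_nat. ring.
- rewrite continuant_SS, IH1, IH0.
  rewrite (continuant_SS th (i+1) (S n)), (continuant_SS th (i+2) n).
  replace (i + Z.of_nat (S (S (S n))))%Z with (i + 1 + Z.of_nat (S (S n)))%Z by lia.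
  replace (i + 2 + Z.of_nat (S n))%Z with (i + 1 + Z.of_nat (S (S n)))%Z by lia.
  ring.
Qed.

Fixpoint csum (f : Z -> C) (lo : Z) (n : nat) : C :=
  match n with
  | O => 0%C
  | S k => (csum f lo k + f (lo + Z.of_nat k)%Z)%C
  end.

Lemma csum_ext (f h : Z -> C) lo n :
  (forall j, (lo <= j < lo + Z.of_nat n)%Z -> f j = h j) -> csum f lo n = csum h lo n.
Proof.
induction n as [|n IH]; intros H; simpl; auto.
rewrite IH, H by (try (intros; apply H); lia). reflexivity.
Qed.

Lemma csum_plus (f h : Z -> C) lo n :
  csum (fun j => f j + h j)%C lo n = (csum f lo n + csum h lo n)%C.
Proof. induction n as [|n IH]; simpl; [|rewrite IH]; ring. Qed.

Lemma csum_scal (c : C) (f : Z -> C) lo n : csum (fun j => c * f j)%C lo n = (c * csum f lo n)%C.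
Proof. induction n as [|n IH]; simpl; [|rewrite IH]; ring. Qed.

Lemma csum_telescope (f : Z -> C) lo n :
  csum (fun j => f (j + 1)%Z - f j)%C lo n = (f (lo + Z.of_nat n)%Z - f lo)%C.
Proof.
induction n as [|n IH].
- simpl. rewrite Z.add_0_r. ring.
- cbn [csum]. rewrite IH.
  replace (lo + Z.of_nat n + 1)%Z with (lo + Z.of_nat (S n))%Z by lia. ring.
Qed.

Lemma csum_zero (f : Z -> C) lo n :
  (forall j, (lo <= j < lo + Z.of_nat n)%Z -> f j = 0%C) -> csum f lo n = 0%C.
Proof.
induction n as [|n IH]; intros H; simpl; auto.
rewrite IH, H by (try (intros; apply H); lia). ring.
Qed.

Lemma csum_single (f : Z -> C) lo n j0 :
  (lo <= j0 < lo + Z.of_nat n)%Z ->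
  (forall j, (lo <= j < lo + Z.of_nat n)%Z -> j <> j0 -> f j = 0%C) ->
  csum f lo n = f j0.
Proof.
induction n as [|n IH]; intros Hj H; [lia|]. cbn [csum].
destruct (Z.eq_dec j0 (lo + Z.of_nat n)) as [->|Hne].
- rewrite csum_zero; [ring|]. intros j Hj'; apply H; lia.
- rewrite IH; [|lia|intros; apply H; lia]. rewrite (H (lo + Z.of_nat n)%Z) by lia. ring.
Qed.

Lemma csum_const (c : C) lo n : csum (fun _ => c) lo n = (INR n * c)%C.
Proof.
induction n as [|n IH]; cbn [csum]; [simpl; ring|].
rewrite IH, S_INR, RtoC_plus. ring.
Qed.

Lemma Ceq_zero_l (a b : C) : a <> 0%C -> (a * b)%C = 0%C -> b = 0%C.
Proof.
intros Ha H. replace b with (/ a * (a * b))%C by (field; exact Ha).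
rewrite H. ring.
Qed.

Lemma Cminus_neq (a b : C) : a <> b -> (a - b)%C <> 0%C.
Proof. intros H H0. apply H. replace a with (a - b + b)%C by ring. rewrite H0. ring. Qed.

(** * The trace of the period matrix *)

(** [exp (i th)] is a primitive [m]-th root of unity. *)
Definition primitive_angle (th : R) (m : nat) : Prop :=
  xpow th (Z.of_nat m) = 1%C /\
  forall k, (0 < k < Z.of_nat m)%Z -> xpow th k <> 1%C.

Lemma xpow_period th m i : primitive_angle th m -> xpow th (i + Z.of_nat m) = xpow th i.
Proof. intros [H _]. rewrite xpow_plus, H. ring. Qed.

Lemma xpow_mul_period th m k :
  xpow th (Z.of_nat m) = 1%C -> xpow th (Z.of_nat m * Z.of_nat k) = 1%C.
Proof.
intros H. induction k as [|k IH].
- rewrite Z.mul_0_r. apply xpow_0.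
- replace (Z.of_nat m * Z.of_nat (S k))%Z with (Z.of_nat m * Z.of_nat k + Z.of_nat m)%Z by lia.
  rewrite xpow_plus, IH, H. ring.
Qed.

Lemma geometric th m l : primitive_angle th m -> (0 < l < Z.of_nat m)%Z ->
  csum (fun i => xpow th (i * l)) 0 m = 0%C.
Proof.
intros [Hm Hp] Hl. apply (Ceq_zero_l (xpow th l - 1)%C).
- apply Cminus_neq, Hp, Hl.
- (* Multiplying by [x^l] shifts the sum by one step, and [x^(m l) = 1]. *)
  rewrite <- csum_scal.
  rewrite (csum_ext _ (fun i => xpow th ((i+1) * l) - xpow th (i * l))%C).
  + rewrite (csum_telescope (fun i => xpow th (i * l))).
    rewrite Z.add_0_l, Z.mul_0_l, xpow_0.
    replace (Z.of_nat m * l)%Z with (Z.of_nat m * Z.of_nat (Z.to_nat l))%Z by lia.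
    rewrite xpow_mul_period by exact Hm. ring.
  + intros j _. replace ((j + 1) * l)%Z with (l + j * l)%Z by ring.
    rewrite xpow_plus. ring.
Qed.

(** As a polynomial in [z = x^i], the continuant has degree at most [n / 2] and constant
    term 1.  Multiplied by [z^l] it still has degree below [m], so its average over the
    [m]-th roots of unity is its constant term.  The recurrence trades [n] for [l],
    which gives an induction that never mentions coefficients. *)
Lemma continuant_average th m o : primitive_angle th m -> forall n l,
  (0 <= l)%Z -> (2 * l + Z.of_nat n < 2 * Z.of_nat m)%Z ->
  csum (fun i => xpow th (i * l) * continuant th (i + o) n)%C 0 m
  = if Z.eq_dec l 0 then INR m else 0%C.
Proof.
intros Hp n.
assert (base : forall l, (0 <= l < Z.of_nat m)%Z ->
  csum (fun i => xpow th (i * l)) 0 m = if Z.eq_dec l 0 then INR m else 0%C).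
{ intros l Hl. destruct (Z.eq_dec l 0) as [->|Hne].
  - rewrite (csum_ext _ (fun _ => 1%C)).
    + rewrite csum_const. ring.
    + intros j _. rewrite Z.mul_0_r. apply xpow_0.
  - apply geometric; [exact Hp|lia]. }
induction n as [| |n IH0 IH1] using nat_ind2; intros l Hl Hn.
- rewrite <- base by lia. apply csum_ext; intros; simpl; ring.
- rewrite <- base by lia. apply csum_ext; intros; simpl; ring.
- rewrite (csum_ext _ (fun i => xpow th (i * l) * continuant th (i + o) (S n)
      + xpow th (o + Z.of_nat (S n)) * (xpow th (i * (l + 1)) * continuant th (i + o) n))%C).
  + rewrite csum_plus, csum_scal, IH1, IH0 by lia.
    destruct (Z.eq_dec (l + 1) 0); [lia|]. ring.
  + intros j _. rewrite continuant_SS.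
    replace (j * (l + 1))%Z with (j * l + j)%Z by ring.
    replace (j + o + Z.of_nat (S n))%Z with (j + (o + Z.of_nat (S n)))%Z by ring.
    rewrite !xpow_plus. ring.
Qed.

(** The trace of the matrix product over the [m = k + 2] factors starting at [i]. *)
Definition period_trace th (k : nat) (i : Z) : C :=
  (continuant th i (S (S k)) + xpow th i * continuant th (i + 1) k)%C.

(** A trace of a product is invariant under cyclic permutation of the factors, and
    [x^(i+m) = x^i]; here this is a comparison of left and right expansions. *)
Lemma period_trace_shift th k i : primitive_angle th (S (S k)) ->
  period_trace th k (i + 1) = period_trace th k i.
Proof.
intros Hp. unfold period_trace. rewrite (continuant_left th i), continuant_SS.
replace (i + 1 + Z.of_nat (S k))%Z with (i + Z.of_nat (S (S k)))%Z by lia.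
rewrite xpow_period by exact Hp. replace (i + 1 + 1)%Z with (i + 2)%Z by ring. ring.
Qed.

(** By cyclic invariance the trace equals its average over all starting points, and
    the average is the constant term of a polynomial of degree less than [m]. *)
Lemma period_trace_one th k : primitive_angle th (S (S k)) ->
  (continuant th 0 (S (S k)) + continuant th 1 k)%C = 1%C.
Proof.
intros Hp.
assert (Hc : forall n : nat, period_trace th k (Z.of_nat n) = period_trace th k 0).
{ induction n as [|n IH]; auto. replace (Z.of_nat (S n)) with (Z.of_nat n + 1)%Z by lia.
  rewrite period_trace_shift by exact Hp. exact IH. }
assert (Hm : RtoC (INR (S (S k))) <> 0%C).
{ intros H. apply (f_equal fst) in H. revert H. apply (not_0_INR (S (S k))). lia. }
assert (H : csum (period_trace th k) 0 (S (S k)) = INR (S (S k))).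
{ unfold period_trace. rewrite csum_plus.
  pose proof (continuant_average th _ 0 Hp (S (S k)) 0) as H1.
  pose proof (continuant_average th _ 1 Hp k 1) as H2.
  destruct (Z.eq_dec 0 0) as [_|]; [|lia]. destruct (Z.eq_dec 1 0) as [|_]; [lia|].
  rewrite <- (Cplus_0_r (INR (S (S k)))), <- H1, <- H2 by lia. f_equal.
  - apply csum_ext; intros j _. rewrite Z.mul_0_r, xpow_0, Z.add_0_r. ring.
  - apply csum_ext; intros j _. now rewrite Z.mul_1_r. }
rewrite (csum_ext _ (fun _ => period_trace th k 0)) in H.
- rewrite csum_const in H. unfold period_trace in H. rewrite xpow_0 in H. simpl (0 + 1)%Z in H.
  set (x := (continuant th 0 (S (S k)) + continuant th 1 k)%C).
  replace x with (/ INR (S (S k)) * (INR (S (S k)) * x))%C by (field; exact Hm).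
  unfold x. rewrite <- (Cmult_1_l (continuant th 1 k)), H. field. exact Hm.
- intros j Hj. rewrite <- (Hc (Z.to_nat j)). f_equal. lia.
Qed.

(** * Solutions of the recurrence and the period matrix *)

(** Index [n] here is index [n - 1] of [P] and [Q]: the recurrence then starts from
    [P_(-1) = 1], [Q_(-1) = 0] and a block of length [m] starts at a multiple of [m]. *)
Definition solves (th : R) (u : nat -> C) : Prop :=
  forall n, u (S (S n)) = (u (S n) + xpow th (Z.of_nat (S n)) * u n)%C.

Lemma solves_unique th u v : solves th u -> solves th v ->
  u 0%nat = v 0%nat -> u 1%nat = v 1%nat -> forall n, u n = v n.
Proof.
intros Hu Hv H0 H1 n. induction n as [| |n IH0 IH1] using nat_ind2; auto.
now rewrite Hu, Hv, IH0, IH1.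
Qed.

Definition solP (th : R) (n : nat) : C := continuant th 0 n.

Definition solQ (th : R) (n : nat) : C :=
  match n with O => 0%C | S k => continuant th 1 k end.

Lemma solP_solves th : solves th (solP th).
Proof. intros n. unfold solP. rewrite continuant_SS. f_equal. Qed.

Lemma solQ_solves th : solves th (solQ th).
Proof.
intros [|n]; [simpl; ring|]. unfold solQ. rewrite continuant_SS.
do 3 f_equal. lia.
Qed.

Lemma P_solP th n : P (cis th) n = solP th (S n).
Proof.
induction n as [| |n IH0 IH1] using nat_ind2; try reflexivity.
- unfold solP. rewrite continuant_SS. simpl (continuant _ _ _).
  unfold xpow. simpl. rewrite Rmult_1_r. ring.
- change (P (cis th) (S (S n))) with (P (cis th) (S n) + cis th ^ (S (S n)) * P (cis th) n)%C.
  now rewrite (solP_solves th (S n)), IH0, IH1, cis_Cpow.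
Qed.

Lemma Q_solQ th n : Q (cis th) n = solQ th (S n).
Proof.
induction n as [| |n IH0 IH1] using nat_ind2; try reflexivity.
change (Q (cis th) (S (S n))) with (Q (cis th) (S n) + cis th ^ (S (S n)) * Q (cis th) n)%C.
now rewrite (solQ_solves th (S n)), IH0, IH1, cis_Cpow.
Qed.

(** [solP] and [solQ] span the solutions, so they give the transfer matrix of a block. *)
Lemma solves_decomp th u : solves th u ->
  forall n, u n = (solQ th n * u 1%nat + (solP th n - solQ th n) * u 0%nat)%C.
Proof.
intros Hu. apply (solves_unique th).
- exact Hu.
- intros n. rewrite solP_solves, solQ_solves. ring.
- simpl. unfold solP; simpl. ring.
- simpl. unfold solP; simpl. ring.
Qed.

Lemma solves_shift th m u : xpow th (Z.of_nat m) = 1%C -> solves th u ->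
  forall k, solves th (fun n => u (k * m + n)%nat).
Proof.
intros Hm Hu k n. rewrite <- !plus_n_Sm, Hu. do 2 f_equal.
replace (Z.of_nat (S (k * m + n))) with (Z.of_nat m * Z.of_nat k + Z.of_nat (S n))%Z by lia.
rewrite xpow_plus, xpow_mul_period by exact Hm. ring.
Qed.

(** Each step multiplies the determinant of two solutions by [- x^(n+1)]. *)
Lemma casoratian th n :
  (solP th (S n) * solQ th n - solP th n * solQ th (S n))%C
  = (- cis (PI * INR n + th * (INR n * (INR n + 1) / 2)))%C.
Proof.
induction n as [|n IH].
- unfold solP; simpl. replace (PI * 0 + th * (0 * (0 + 1) / 2)) with 0 by field.
  rewrite cis_0. ring.
- rewrite solP_solves, solQ_solves.
  transitivity (- (xpow th (Z.of_nat (S n)) *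
    (solP th (S n) * solQ th n - solP th n * solQ th (S n))))%C; [ring|].
  rewrite IH. unfold xpow. rewrite <- INR_IZR_INZ.
  replace (PI * INR (S n) + th * (INR (S n) * (INR (S n) + 1) / 2))
   with (PI + th * INR (S n) + (PI * INR n + th * (INR n * (INR n + 1) / 2)))
   by (rewrite S_INR; field).
  rewrite !cis_plus, cis_PI. ring.
Qed.

(** Cayley-Hamilton for the period matrix, of trace 1 and determinant [-1]. *)
Lemma period_recurrence th m u : primitive_angle th m -> (2 <= m)%nat ->
  (solP th m * solQ th (m - 1) - solP th (m - 1) * solQ th m)%C = (- (1))%C ->
  solves th u ->
  forall k, u ((S (S k)) * m)%nat = (u (S k * m)%nat + u (k * m)%nat)%C.
Proof.
intros Hp Hm Hdet Hu k.
destruct m as [|[|j]]; try lia.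
assert (Hdet' : (solP th (S (S j)) * solQ th (S j) - solP th (S j) * solQ th (S (S j)))%C
  = (- (1))%C) by (rewrite <- Hdet; repeat f_equal; lia).
clear Hdet. pose proof (period_trace_one th j Hp) as Htr.
set (m := S (S j)) in *. destruct Hp as [Hm1 _].
assert (Hv := solves_decomp th _ (solves_shift th m u Hm1 Hu k)). cbv beta in Hv.
assert (Hw := solves_decomp th _ (solves_shift th m u Hm1 Hu (S k))). cbv beta in Hw.
specialize (Hw m).
pose proof (Hv m) as V0. pose proof (Hv (S m)) as V1. clear Hv.
replace (S k * m + m)%nat with (S (S k) * m)%nat in Hw by lia.
replace (S k * m + 1)%nat with (k * m + S m)%nat in Hw by lia.
replace (S k * m + 0)%nat with (S k * m)%nat in Hw by lia.
replace (k * m + m)%nat with (S k * m)%nat in V0 by lia.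
rewrite Nat.add_0_r in V0, V1.
replace (solP th (S m)) with (solP th m + solP th (S j))%C in V1
 by (unfold m; rewrite (solP_solves th (S j)); fold m; rewrite Hm1; ring).
replace (solQ th (S m)) with (solQ th m + solQ th (S j))%C in V1
 by (unfold m; rewrite (solQ_solves th (S j)); fold m; rewrite Hm1; ring).
change (solP th m + solQ th (S j) = 1)%C in Htr.
rewrite Hw, V1, V0.
set (p := solP th m) in *. set (q := solP th (S j)) in *.
set (r := solQ th m) in *. set (s := solQ th (S j)) in *.
set (a := u (k * m + 1)%nat). set (b := u (k * m)%nat).
replace s with (1 - p)%C in * by (rewrite <- Htr; ring).
(* [a = u_(km+1)] and [b = u_(km)]; the two sides differ by [b] times [det + 1]. *)
transitivity (r * a + (p - r) * b + b - b * ((p * (1 - p) - q * r) + 1))%C; [ring|].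
rewrite Hdet'. ring.
Qed.

(** * Fibonacci numbers *)

Fixpoint fib (n : nat) : nat :=
  match n with
  | O => 0
  | S m => match m with O => 1 | S k => fib m + fib k end
  end%nat.

Lemma fib_SS n : fib (S (S n)) = (fib (S n) + fib n)%nat.
Proof. reflexivity. Qed.

Lemma fib_recurrence (v : nat -> C) :
  (forall k, v (S (S k)) = (v (S k) + v k)%C) ->
  forall k, v (S k) = (INR (fib (S k)) * v 1%nat + INR (fib k) * v 0%nat)%C.
Proof.
intros H k. induction k as [| |k IH0 IH1] using nat_ind2.
- simpl. ring.
- rewrite H. simpl. ring.
- rewrite H, IH0, IH1, (fib_SS (S k)), (fib_SS k), !plus_INR, !RtoC_plus. ring.
Qed.

(** * Schur's polynomial identities *)

(** The Gaussian binomial coefficient at [x], as a function of an integer [k] so that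
    Schur's sums can run over all integers without boundary cases. *)
Fixpoint qbin (th : R) (n : nat) (k : Z) : C :=
  match n with
  | O => if Z.eq_dec k 0 then 1%C else 0%C
  | S m => (qbin th m (k - 1) + xpow th k * qbin th m k)%C
  end.

Lemma qbin_S th n k : qbin th (S n) k = (qbin th n (k - 1) + xpow th k * qbin th n k)%C.
Proof. reflexivity. Qed.

(** The second q-Pascal rule; the recurrence in [qbin] is the first. *)
Lemma qbin_S_alt th n k :
  qbin th (S n) k = (xpow th (Z.of_nat (S n) - k) * qbin th n (k - 1) + qbin th n k)%C.
Proof.
revert k. induction n as [|n IH]; intros k.
- cbn [qbin]. destruct (Z.eq_dec (k - 1) 0), (Z.eq_dec k 0); try lia.
  + replace (Z.of_nat 1 - k)%Z with 0%Z by lia. rewrite xpow_0. ring.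
  + subst k. rewrite xpow_0. ring.
  + ring.
- rewrite (qbin_S th (S n)), (IH (k - 1)%Z) at 1. rewrite (IH k) at 1.
  rewrite (qbin_S th n k), (qbin_S th n (k - 1)).
  replace (Z.of_nat (S n) - (k - 1))%Z with (Z.of_nat (S n) - k + 1)%Z by lia.
  replace (Z.of_nat (S (S n)) - k)%Z with (Z.of_nat (S n) - k + 1)%Z by lia.
  rewrite (xpow_plus th (Z.of_nat (S n) - k)).
  replace (xpow th k) with (xpow th (k - 1) * xpow th 1)%C by (rewrite <- xpow_plus; f_equal; lia).
  ring.
Qed.

Lemma qbin_outside th n k : (k < 0 \/ Z.of_nat n < k)%Z -> qbin th n k = 0%C.
Proof.
revert k. induction n as [|n IH]; intros k Hk.
- simpl. destruct (Z.eq_dec k 0); [lia|reflexivity].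
- rewrite qbin_S, !IH by lia. ring.
Qed.

Lemma qbin_0 th n : qbin th n 0 = 1%C.
Proof.
induction n as [|n IH]; [reflexivity|].
rewrite qbin_S, IH, xpow_0, qbin_outside by lia. ring.
Qed.

Lemma qbin_top th n : qbin th n (Z.of_nat n) = 1%C.
Proof.
induction n as [|n IH]; [reflexivity|].
rewrite qbin_S, (qbin_outside th n (Z.of_nat (S n))) by lia.
replace (Z.of_nat (S n) - 1)%Z with (Z.of_nat n) by lia. rewrite IH. ring.
Qed.

(** The two q-Pascal rules combine to [(1 - x^k) [n+1; k] = (1 - x^(n+1)) [n; k-1]]. *)
Lemma qbin_inside th m k : primitive_angle th m ->
  (0 < k < Z.of_nat m)%Z -> qbin th m k = 0%C.
Proof.
intros [H1 Hp] Hk. destruct m as [|n]; [lia|].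
apply (Ceq_zero_l (1 - xpow th k)%C).
- apply Cminus_neq. intros H. now apply (Hp k).
- transitivity (qbin th (S n) k - xpow th k * qbin th (S n) k)%C; [ring|].
  rewrite qbin_S at 1. rewrite qbin_S_alt.
  transitivity ((1 - xpow th (k + (Z.of_nat (S n) - k))) * qbin th n (k - 1))%C.
  + rewrite xpow_plus. ring.
  + replace (k + (Z.of_nat (S n) - k))%Z with (Z.of_nat (S n)) by ring.
    rewrite H1. ring.
Qed.

(** [(-1)^j x^(j (5 j + 1 - 2 s) / 2)]; writing it as one angle avoids halving an
    integer and cases on the parity of [j]. *)
Definition weight (th : R) (s j : Z) : C :=
  cis (PI * IZR j + th * (IZR j * (5 * IZR j + 1 - 2 * IZR s) / 2)).

Lemma weight_succ th s j :
  weight th s (j + 1) = (- (xpow th (5 * j + 3 - s) * weight th s j))%C.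
Proof.
unfold weight, xpow. rewrite <- cis_plus.
transitivity (cis PI * cis (th * IZR (5 * j + 3 - s) +
  (PI * IZR j + th * (IZR j * (5 * IZR j + 1 - 2 * IZR s) / 2))))%C.
- rewrite <- cis_plus. f_equal.
  rewrite minus_IZR, !plus_IZR, mult_IZR. field.
- rewrite cis_PI. ring.
Qed.

Definition schur_term (th : R) (s : Z) (n : nat) (j : Z) : C :=
  (weight th s j * qbin th n ((Z.of_nat n + s - 5 * j) / 2))%C.

(** Schur's alternating sum, truncated to [|j| <= J].  For [J] large enough compared with
    [n] the omitted terms vanish. *)
Definition schur_sum (th : R) (s : Z) (J n : nat) : C :=
  csum (schur_term th s n) (- Z.of_nat J) (2 * J + 1).

(** Telescoping certificate for the recurrence of the sums.  After both q-Pascal rules,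
    the terms with [n + 2 + s - 5 j] odd leave a remainder that cancels against the
    remainder of the next term, whose parity is even; so it is recorded at even
    positions only. *)
Definition schur_cert (th : R) (s : Z) (n : nat) (j : Z) : C :=
  let N := (Z.of_nat n + 2 + s - 5 * j)%Z in
  if Z.even N then (- (weight th s j * (xpow th (N / 2) * qbin th n (N / 2))))%C else 0%C.

Lemma schur_term_telescope th s n j :
  (schur_term th s (S (S n)) j - schur_term th s (S n) j
   - xpow th (Z.of_nat (S n)) * schur_term th s n j)%C
  = (schur_cert th s n (j + 1) - schur_cert th s n j)%C.
Proof.
unfold schur_term, schur_cert.
replace (Z.of_nat (S (S n)) + s - 5 * j)%Z with (Z.of_nat n + 2 + s - 5 * j)%Z by lia.
replace (Z.of_nat (S n) + s - 5 * j)%Z with (Z.of_nat n + 2 + s - 5 * j - 1)%Z by lia.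
replace (Z.of_nat n + s - 5 * j)%Z with (Z.of_nat n + 2 + s - 5 * j - 2)%Z by lia.
replace (Z.of_nat n + 2 + s - 5 * (j + 1))%Z with (Z.of_nat n + 2 + s - 5 * j - 5)%Z by lia.
remember (Z.of_nat n + 2 + s - 5 * j)%Z as N eqn:HN.
destruct (Z.Even_or_Odd N) as [[k Hk]|[k Hk]].
- replace (Z.even N) with true by (symmetry; apply Z.even_spec; now exists k).
  replace (Z.even (N - 5)) with false
   by (symmetry; rewrite <- Z.negb_odd; apply Bool.negb_false_iff, Z.odd_spec;
       exists (k - 3)%Z; lia).
  replace (N / 2)%Z with k by (Z.to_euclidean_division_equations; lia).
  replace ((N - 1) / 2)%Z with (k - 1)%Z by (Z.to_euclidean_division_equations; lia).
  replace ((N - 2) / 2)%Z with (k - 1)%Z by (Z.to_euclidean_division_equations; lia).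
  rewrite (qbin_S th (S n)), (qbin_S_alt th n k).
  replace (Z.of_nat (S n)) with (k + (Z.of_nat (S n) - k))%Z at 2 by ring.
  rewrite xpow_plus. ring.
- replace (Z.even N) with false
   by (symmetry; rewrite <- Z.negb_odd; apply Bool.negb_false_iff, Z.odd_spec; now exists k).
  replace (Z.even (N - 5)) with true
   by (symmetry; apply Z.even_spec; exists (k - 2)%Z; lia).
  replace (N / 2)%Z with k by (Z.to_euclidean_division_equations; lia).
  replace ((N - 1) / 2)%Z with k by (Z.to_euclidean_division_equations; lia).
  replace ((N - 2) / 2)%Z with (k - 1)%Z by (Z.to_euclidean_division_equations; lia).
  replace ((N - 5) / 2)%Z with (k - 2)%Z by (Z.to_euclidean_division_equations; lia).
  rewrite (qbin_S_alt th (S n)), (qbin_S th n (k - 1)), weight_succ.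
  replace (k - 1 - 1)%Z with (k - 2)%Z by ring.
  replace (Z.of_nat (S (S n)) - k)%Z with (5 * j + 3 - s + (k - 2))%Z by lia.
  replace (Z.of_nat (S n)) with (5 * j + 3 - s + (k - 2) + (k - 1))%Z by lia.
  rewrite !xpow_plus. ring.
Qed.

Lemma schur_sum_recurrence th s J n :
  (Z.of_nat n + 2 + Z.abs s <= 5 * Z.of_nat J)%Z ->
  schur_sum th s J (S (S n))
  = (schur_sum th s J (S n) + xpow th (Z.of_nat (S n)) * schur_sum th s J n)%C.
Proof.
intros HJ.
(* The certificate vanishes at both ends because its q-binomials are out of range there. *)
assert (H : csum (fun j => schur_cert th s n (j + 1) - schur_cert th s n j)%C
   (- Z.of_nat J) (2 * J + 1) = 0%C).
{ rewrite csum_telescope. unfold schur_cert.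
  rewrite !qbin_outside by (Z.to_euclidean_division_equations; lia).
  destruct (Z.even _), (Z.even _); ring. }
rewrite (csum_ext _ (fun j => schur_term th s (S (S n)) j +
  ((- (1)) * schur_term th s (S n) j
   + (- xpow th (Z.of_nat (S n))) * schur_term th s n j))%C) in H
 by (intros; rewrite <- schur_term_telescope; ring).
rewrite !csum_plus, !csum_scal in H. unfold schur_sum.
rewrite <- (Cplus_0_r (_ + _)), <- H. ring.
Qed.

Ltac zdiv := Z.to_euclidean_division_equations; lia.

Lemma weight_0 th s : weight th s 0 = 1%C.
Proof.
unfold weight. rewrite <- cis_0. f_equal. field.
Qed.

Lemma schur_term_outside th s n j :
  ((Z.of_nat n + s - 5 * j) / 2 < 0 \/ Z.of_nat n < (Z.of_nat n + s - 5 * j) / 2)%Z ->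
  schur_term th s n j = 0%C.
Proof. intros H. unfold schur_term. rewrite qbin_outside by exact H. ring. Qed.

(** The terms that survive at [n = m] for a primitive [m]-th root of unity. *)
Lemma schur_term_edge th s n j :
  ((Z.of_nat n + s - 5 * j) / 2 = 0 \/ (Z.of_nat n + s - 5 * j) / 2 = Z.of_nat n)%Z ->
  schur_term th s n j = weight th s j.
Proof.
intros H. unfold schur_term. destruct H as [-> | ->]; [rewrite qbin_0|rewrite qbin_top]; ring.
Qed.

Lemma schur_term_inside th s m j : primitive_angle th m ->
  ((Z.of_nat m + s - 5 * j) / 2 <> 0)%Z ->
  ((Z.of_nat m + s - 5 * j) / 2 <> Z.of_nat m)%Z ->
  schur_term th s m j = 0%C.
Proof.
intros Hp H0 Hm. unfold schur_term.
destruct (Z_lt_le_dec ((Z.of_nat m + s - 5 * j) / 2) 0);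
 [rewrite qbin_outside by lia; ring|].
destruct (Z_lt_le_dec (Z.of_nat m) ((Z.of_nat m + s - 5 * j) / 2));
 [rewrite qbin_outside by lia; ring|].
rewrite qbin_inside by (auto; lia). ring.
Qed.

(** Schur's identity for [P_(n-1)]: both sides solve the same recurrence. *)
Lemma schur_identity_P th J n : (1 <= J)%nat -> (n <= 5 * J)%nat ->
  solP th n = schur_sum th 0 J n.
Proof.
intros HJ. induction n as [| |n IH0 IH1] using nat_ind2; intros Hn.
- unfold schur_sum. rewrite (csum_single (schur_term th _ _) _ _ 0)
   by (lia || (intros; apply schur_term_outside; zdiv)).
  rewrite schur_term_edge by zdiv. now rewrite weight_0.
- unfold schur_sum. rewrite (csum_single (schur_term th _ _) _ _ 0)
   by (lia || (intros; apply schur_term_outside; zdiv)).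
  rewrite schur_term_edge by zdiv. now rewrite weight_0.
- rewrite schur_sum_recurrence, solP_solves, IH0, IH1 by lia. reflexivity.
Qed.

Lemma schur_identity_Q th J n : (1 <= J)%nat -> (n + 2 <= 5 * J)%nat ->
  solQ th n = schur_sum th 2 J n.
Proof.
intros HJ. induction n as [| |n IH0 IH1] using nat_ind2; intros Hn.
- unfold schur_sum. now rewrite csum_zero by (intros; apply schur_term_outside; zdiv).
- unfold schur_sum. rewrite (csum_single (schur_term th _ _) _ _ 0)
   by (lia || (intros; apply schur_term_outside; zdiv)).
  rewrite schur_term_edge by zdiv. now rewrite weight_0.
- rewrite schur_sum_recurrence, solQ_solves, IH0, IH1 by lia. reflexivity.
Qed.

(** The condition on [j] says that the lower index of the q-binomial is 0 or [m]. *)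
Lemma solP_at_period th m (j : Z) : primitive_angle th m -> (2 <= m)%nat ->
  (5 * j = Z.of_nat m - 1 \/ 5 * j = - Z.of_nat m - 1)%Z ->
  solP th m = weight th 0 j.
Proof.
intros Hp Hm Hj. rewrite (schur_identity_P th m) by lia.
unfold schur_sum. rewrite (csum_single (schur_term th _ _) _ _ j).
- apply schur_term_edge. zdiv.
- lia.
- intros i _ Hi. apply schur_term_inside; [exact Hp|zdiv|zdiv].
Qed.

(** For these residues no [j] puts the lower index at 0 or [m]. *)
Lemma solP_at_period_0 th m : primitive_angle th m -> (2 <= m)%nat ->
  (m mod 5 = 2 \/ m mod 5 = 3)%nat -> solP th m = 0%C.
Proof.
intros Hp Hm Hr. rewrite (schur_identity_P th m) by lia.
unfold schur_sum. apply csum_zero.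
assert (Z.of_nat m mod 5 = 2 \/ Z.of_nat m mod 5 = 3)%Z.
{ destruct Hr as [Hr|Hr]; [left|right]; apply (f_equal Z.of_nat) in Hr;
  rewrite Nat2Z.inj_mod in Hr; exact Hr. }
intros i _. apply schur_term_inside; [exact Hp|zdiv|zdiv].
Qed.

Lemma solQ_at_period th m (j : Z) : primitive_angle th m -> (2 <= m)%nat ->
  (5 * j = 1 - Z.of_nat m \/ 5 * j = 2 - Z.of_nat m \/
   5 * j = Z.of_nat m + 2 \/ 5 * j = Z.of_nat m + 1)%Z ->
  solQ th m = weight th 2 j.
Proof.
intros Hp Hm Hj. rewrite (schur_identity_Q th m) by lia.
unfold schur_sum. rewrite (csum_single (schur_term th _ _) _ _ j).
- apply schur_term_edge. zdiv.
- lia.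
- intros i _ Hi. apply schur_term_inside; [exact Hp|zdiv|zdiv].
Qed.

(** * Values after one period at a root of unity *)

Definition rat_angle (c m : nat) : R := 2 * PI * (INR c / INR m).

Lemma rat_angle_primitive c m : (2 <= m)%nat -> rel_prime (Z.of_nat c) (Z.of_nat m) ->
  primitive_angle (rat_angle c m) m.
Proof.
intros Hm Hg. assert (Hm0 : INR m <> 0) by (apply not_0_INR; lia).
unfold primitive_angle, xpow, rat_angle. split.
- rewrite <- (cis_2PI_Z (Z.of_nat c)). f_equal. rewrite <- !INR_IZR_INZ. field. exact Hm0.
- intros k Hk H. destruct (cis_eq_1 _ H) as [z Hz].
  assert (Hz' : INR c * IZR k = IZR z * INR m).
  { apply (Rmult_eq_reg_l (2 * PI)); [|generalize PI_RGT_0; lra].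
    transitivity (2 * PI * IZR z * INR m); [rewrite <- Hz; field; exact Hm0|ring]. }
  rewrite !INR_IZR_INZ, <- !mult_IZR in Hz'. apply eq_IZR in Hz'.
  assert (Hd : (Z.of_nat m | k)%Z).
  { apply (Gauss _ (Z.of_nat c)); [exists z; exact Hz'|].
    now apply rel_prime_sym. }
  apply Z.divide_pos_le in Hd; lia.
Qed.

Lemma coprime_parity c m : rel_prime (Z.of_nat c) (Z.of_nat m) ->
  Z.even (Z.of_nat c) = true -> Z.even (Z.of_nat m) = true -> False.
Proof.
intros Hg Hc Hm. apply Z.even_spec in Hc, Hm. destruct Hc as [x Hx], Hm as [y Hy].
destruct (rel_prime_bezout _ _ Hg) as [u v Huv]. rewrite Hx, Hy in Huv. lia.
Qed.

(** The sign works out because [c] and [m] are not both even: [(m - 1) (1 + c)] is even. *)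
Lemma period_det c m : (2 <= m)%nat -> rel_prime (Z.of_nat c) (Z.of_nat m) ->
  let th := rat_angle c m in
  (solP th m * solQ th (m - 1) - solP th (m - 1) * solQ th m)%C = (- (1))%C.
Proof.
intros Hm Hg th. pose proof (casoratian th (m - 1)) as H.
replace (S (m - 1)) with m in H by lia. rewrite H. f_equal.
rewrite <- (cis_PI_even ((Z.of_nat m - 1) * (1 + Z.of_nat c))).
- f_equal. unfold th, rat_angle.
  rewrite mult_IZR, minus_IZR, plus_IZR, <- !INR_IZR_INZ, minus_INR by lia. simpl (INR 1).
  field. apply not_0_INR; lia.
- apply Z.even_spec. pose proof (coprime_parity c m Hg).
  rewrite Z.even_mul, Z.even_sub, Z.even_add.
  destruct (Z.even (Z.of_nat m)), (Z.even (Z.of_nat c)); simpl; tauto.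
Qed.

Lemma solP_value c m (j : Z) : (2 <= m)%nat -> rel_prime (Z.of_nat c) (Z.of_nat m) ->
  (5 * j = Z.of_nat m - 1 \/ 5 * j = - Z.of_nat m - 1)%Z ->
  solP (rat_angle c m) m = 1%C.
Proof.
intros Hm Hg Hj.
assert (Hm0 : INR m <> 0) by (apply not_0_INR; lia).
rewrite (solP_at_period _ m j) by auto using rat_angle_primitive.
pose proof (coprime_parity c m Hg) as Hpar.
assert (Hj2 : Z.even j = negb (Z.even (Z.of_nat m))).
{ destruct Hj as [Hj|Hj];
  [replace (Z.of_nat m) with (5 * j + 1)%Z by lia|replace (Z.of_nat m) with (- 5 * j - 1)%Z by lia];
  rewrite ?Z.even_add, ?Z.even_sub, Z.even_mul; now destruct (Z.even j). }
destruct Hj as [Hj|Hj].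
- rewrite <- (cis_PI_even (j * (1 + Z.of_nat c))).
  + unfold weight, rat_angle. f_equal. apply (f_equal IZR) in Hj.
    rewrite minus_IZR, mult_IZR, <- INR_IZR_INZ in Hj.
    rewrite mult_IZR, plus_IZR, <- INR_IZR_INZ.
    replace (5 * IZR j) with (INR m - 1) by lra. field. exact Hm0.
  + apply Z.even_spec. rewrite Z.even_mul, Z.even_add, Hj2.
    destruct (Z.even (Z.of_nat m)), (Z.even (Z.of_nat c)); simpl; tauto.
- rewrite <- (cis_PI_even (j * (1 - Z.of_nat c))).
  + unfold weight, rat_angle. f_equal. apply (f_equal IZR) in Hj.
    rewrite minus_IZR, mult_IZR, opp_IZR, <- INR_IZR_INZ in Hj.
    rewrite mult_IZR, minus_IZR, <- INR_IZR_INZ.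
    replace (5 * IZR j) with (- INR m - 1) by lra. field. exact Hm0.
  + apply Z.even_spec. rewrite Z.even_mul, Z.even_sub, Hj2.
    destruct (Z.even (Z.of_nat m)), (Z.even (Z.of_nat c)); simpl; tauto.
Qed.

(** With [th = 2 pi c / m], the factor [x^(1/5)] completes the quadratic exponent:
    [j (5 j - 3) + 2 / 5 = (5 j - 1) (5 j - 2) / 5].  At the surviving index [j] the modulus
    [m] divides this product, so that the total angle becomes a multiple [N] of [pi / 5]. *)
Lemma weight2_angle c m (j N : Z) : (2 <= m)%nat ->
  (Z.of_nat m * N = 5 * Z.of_nat m * j + Z.of_nat c * ((5 * j - 1) * (5 * j - 2)))%Z ->
  (cis (rat_angle c m / 5) * weight (rat_angle c m) 2 j)%C = cis (PI * IZR N / 5).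
Proof.
intros Hm HN. assert (Hm0 : INR m <> 0) by (apply not_0_INR; lia).
apply (f_equal IZR) in HN.
repeat rewrite ?plus_IZR, ?minus_IZR, ?mult_IZR, <- ?INR_IZR_INZ in HN.
unfold weight, rat_angle. rewrite <- cis_plus. f_equal.
apply (Rmult_eq_reg_l (INR m)); [|exact Hm0].
transitivity (PI / 5 * (INR m * IZR N)); [rewrite HN|]; field. exact Hm0.
Qed.

Lemma cis_fifth_even (N j q : Z) : (N = 2 * j + 5 * q)%Z -> Z.even q = true ->
  cis (PI * IZR N / 5) = cis (2 * PI * IZR j / 5).
Proof.
intros -> Hq. apply Z.even_spec in Hq. rewrite plus_IZR, !mult_IZR.
replace (PI * (2 * IZR j + 5 * IZR q) / 5) with (2 * PI * IZR j / 5 + PI * IZR q) by field.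
rewrite cis_plus, cis_PI_even by exact Hq. ring.
Qed.

Lemma cis_fifth_odd (N j q : Z) : (N = 2 * j + 5 * q)%Z -> Z.even q = false ->
  cis (PI * IZR N / 5) = (- cis (2 * PI * IZR j / 5))%C.
Proof.
intros -> Hq. rewrite <- Z.negb_odd in Hq. apply Bool.negb_false_iff, Z.odd_spec in Hq.
rewrite plus_IZR, !mult_IZR.
replace (PI * (2 * IZR j + 5 * IZR q) / 5) with (2 * PI * IZR j / 5 + PI * IZR q) by field.
rewrite cis_plus, cis_PI_odd by exact Hq. ring.
Qed.

Ltac parity :=
  repeat rewrite ?Z.even_add, ?Z.even_sub, ?Z.even_mul, ?Z.even_opp in *;
  repeat match goal with
  | |- context [Z.even ?x] => is_var x; destruct (Z.even x)
  | H : context [Z.even ?x] |- _ => is_var x; destruct (Z.even x)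
  end; simpl in *; intuition congruence.

Lemma residue_split c m j a r :
  ((j * m) mod 5 = c mod 5)%Z -> (m = 5 * a + r)%Z -> exists b, (c = r * j + 5 * b)%Z.
Proof.
intros Hj ->. exists (j * a + (c / 5 - (j * (5 * a + r)) / 5))%Z.
pose proof (Z.div_mod c 5). pose proof (Z.div_mod (j * (5 * a + r)) 5). lia.
Qed.

(** [j] stands for [c / m] modulo 5. *)
Lemma solQ_value_pos c m (j : Z) : (2 <= m)%nat -> rel_prime (Z.of_nat c) (Z.of_nat m) ->
  ((Z.of_nat m) mod 5 = 1 \/ (Z.of_nat m) mod 5 = 4)%Z ->
  ((j * Z.of_nat m) mod 5 = Z.of_nat c mod 5)%Z ->
  (cis (rat_angle c m / 5) * solQ (rat_angle c m) m)%C = cis (2 * PI * IZR j / 5).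
Proof.
intros Hm Hg Hr Hj.
pose proof (coprime_parity c m Hg) as Hpar.
pose proof (rat_angle_primitive c m Hm Hg) as Hp.
pose proof (Z.div_mod (Z.of_nat m) 5 ltac:(lia)) as Ha.
set (a := (Z.of_nat m / 5)%Z) in Ha. clearbody a.
destruct Hr as [Hr|Hr]; rewrite Hr in Ha; destruct (residue_split _ _ _ _ _ Hj Ha) as [b Hb].
(* [m = 5 a + r] and [c = r j + 5 b]; the quotient [q] of [N - 2 j] by 5 has the required
   parity because [c] and [m] are not both even. *)
- rewrite (solQ_at_period _ m (- a)) by (auto; lia).
  rewrite (weight2_angle c m (- a) (- 5 * a + Z.of_nat c * (5 * a + 2)))
   by (auto; rewrite Ha; ring).
  rewrite Ha, Hb in Hpar.
  apply (cis_fifth_even _ j (a * (Z.of_nat c - 1) + 2 * b)); rewrite Hb; [ring|]. parity.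
- rewrite (solQ_at_period _ m (a + 1)) by (auto; lia).
  rewrite (weight2_angle c m (a + 1) (5 * a + 5 + Z.of_nat c * (5 * a + 3)))
   by (auto; rewrite Ha; ring).
  rewrite Ha, Hb in Hpar.
  apply (cis_fifth_even _ j (a * (Z.of_nat c + 1) + 1 + 2 * j + 3 * b)); rewrite Hb; [ring|].
  parity.
Qed.

(** For the non-squares [m] modulo 5 an extra half turn appears. *)
Lemma solQ_value_neg c m (j : Z) : (2 <= m)%nat -> rel_prime (Z.of_nat c) (Z.of_nat m) ->
  ((Z.of_nat m) mod 5 = 2 \/ (Z.of_nat m) mod 5 = 3)%Z ->
  ((j * Z.of_nat m) mod 5 = Z.of_nat c mod 5)%Z ->
  (cis (rat_angle c m / 5) * solQ (rat_angle c m) m)%C = (- cis (2 * PI * IZR j / 5))%C.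
Proof.
intros Hm Hg Hr Hj.
pose proof (coprime_parity c m Hg) as Hpar.
pose proof (rat_angle_primitive c m Hm Hg) as Hp.
pose proof (Z.div_mod (Z.of_nat m) 5 ltac:(lia)) as Ha.
set (a := (Z.of_nat m / 5)%Z) in Ha. clearbody a.
destruct Hr as [Hr|Hr]; rewrite Hr in Ha; destruct (residue_split _ _ _ _ _ Hj Ha) as [b Hb].
- rewrite (solQ_at_period _ m (- a)) by (auto; lia).
  rewrite (weight2_angle c m (- a) (- 5 * a + Z.of_nat c * (5 * a + 1)))
   by (auto; rewrite Ha; ring).
  rewrite Ha, Hb in Hpar.
  apply (cis_fifth_odd _ j (a * (Z.of_nat c - 1) + b)); rewrite Hb; [ring|]. parity.
- rewrite (solQ_at_period _ m (a + 1)) by (auto; lia).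
  rewrite (weight2_angle c m (a + 1) (5 * a + 5 + Z.of_nat c * (5 * a + 4)))
   by (auto; rewrite Ha; ring).
  rewrite Ha, Hb in Hpar.
  apply (cis_fifth_odd _ j (a * (Z.of_nat c + 1) + 1 + 2 * j + 4 * b)); rewrite Hb; [ring|].
  parity.
Qed.

(** * Convergents at a root of unity *)

Lemma phi_square : phi * phi = phi + 1.
Proof. unfold phi. generalize (sqrt_sqrt 5 ltac:(lra)). nra. Qed.

Lemma phi_bounds : 1 < phi < 2.
Proof.
unfold phi. pose proof (sqrt_sqrt 5 ltac:(lra)). pose proof (sqrt_pos 5). nra.
Qed.

(** [1 - phi] is the conjugate root, of modulus less than 1. *)
Lemma fib_phi n : INR (fib (S n)) - phi * INR (fib n) = (1 - phi) ^ n.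
Proof.
induction n as [|n IH].
- simpl. ring.
- rewrite fib_SS, plus_INR. simpl pow. rewrite <- IH.
  apply Rminus_diag_uniq.
  transitivity (INR (fib n) * (phi + 1 - phi * phi)); [ring|]. rewrite phi_square. ring.
Qed.

Lemma fib_phi_bound n : Rabs (phi * INR (fib n) - INR (fib (S n))) <= 1.
Proof.
rewrite Rabs_minus_sym, fib_phi, <- RPow_abs. apply Rle_trans with (1 ^ n); [|rewrite pow1; lra].
apply pow_incr. destruct phi_bounds. split; [apply Rabs_pos|].
apply Rabs_le. split; lra.
Qed.

Lemma fib_mono n : (fib n <= fib (S n))%nat.
Proof. destruct n; [simpl; lia|]. rewrite fib_SS. lia. Qed.

Lemma fib_ge n : (n <= fib n + 1)%nat.
Proof.
induction n as [| |n IH0 IH1] using nat_ind2; [simpl; lia|simpl; lia|].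
rewrite fib_SS. pose proof (fib_mono n). destruct n as [|[|n]]; simpl in *; lia.
Qed.

Lemma period_multiples c m : (2 <= m)%nat -> rel_prime (Z.of_nat c) (Z.of_nat m) ->
  let th := rat_angle c m in forall k,
  solP th (S k * m) = (INR (fib (S k)) * solP th m + INR (fib k))%C /\
  solQ th (S k * m) = (INR (fib (S k)) * solQ th m)%C.
Proof.
intros Hm Hg th k.
pose proof (rat_angle_primitive c m Hm Hg) as Hp.
pose proof (period_det c m Hm Hg) as Hd.
pose proof (fib_recurrence (fun k => solP th (k * m))
  (period_recurrence th m _ Hp Hm Hd (solP_solves th)) k) as H1.
pose proof (fib_recurrence (fun k => solQ th (k * m))
  (period_recurrence th m _ Hp Hm Hd (solQ_solves th)) k) as H2.
cbv beta in H1, H2. rewrite Nat.mul_1_l, Nat.mul_0_l in H1, H2.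
change (solP th 0) with (RtoC 1) in H1. change (solQ th 0) with (RtoC 0) in H2.
rewrite H1, H2. split; ring.
Qed.

Lemma RtoC_neq_0 (x : R) : x <> 0 -> RtoC x <> 0%C.
Proof. intros H H0. apply H. exact (f_equal fst H0). Qed.

(** [V] is the value of the Rogers-Ramanujan continued fraction at [exp (2 pi i c / m)],
    where [j] is [c / m] modulo 5. *)
Definition root_value (m : nat) (j : Z) (V : C) : Prop :=
  ((Z.of_nat m mod 5 = 1 \/ Z.of_nat m mod 5 = 4)%Z /\
     V = (cis (2 * PI * IZR j / 5) / phi)%C) \/
  ((Z.of_nat m mod 5 = 2 \/ Z.of_nat m mod 5 = 3)%Z /\
     V = (- phi * cis (2 * PI * IZR j / 5))%C).

(** After [K] periods the numerator and denominator are Fibonacci multiples of their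
    values after one period, so the error is that of a Fibonacci quotient for [phi].  The
    first two bounds keep the quotient stable under perturbation. *)
Lemma root_convergent c m (j : Z) K V : (2 <= m)%nat -> (3 <= K)%nat ->
  rel_prime (Z.of_nat c) (Z.of_nat m) ->
  ((j * Z.of_nat m) mod 5 = Z.of_nat c mod 5)%Z ->
  root_value m j V ->
  let th := rat_angle c m in
  1 <= Cmod (solP th (K * m)) /\
  Cmod (solQ th (K * m)) <= 2 * Cmod (solP th (K * m)) /\
  Cmod (cis (th / 5) * (solQ th (K * m) / solP th (K * m)) - V) <= / INR (K - 2).
Proof.
intros Hm HK Hg Hj HV th.
destruct K as [|[|k]]; try lia.
destruct (period_multiples c m Hm Hg (S k)) as [HP HQ].
fold th in HP, HQ. rewrite HP, HQ.
replace (S (S k) - 2)%nat with k by lia.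
pose proof (fib_ge (S k)) as Hge. pose proof (fib_mono (S k)) as Hmono.
pose proof (fib_mono k) as Hmono'. pose proof (fib_SS k) as HS.
destruct phi_bounds as [Hphi Hphi2].
assert (Hk : 1 <= INR k) by (apply (le_INR 1); lia).
assert (HF : INR k <= INR (fib (S k))) by (apply le_INR; lia).
assert (HF2 : INR (fib (S k)) <= INR (fib (S (S k)))) by (apply le_INR; lia).
assert (HF3 : INR (fib (S (S k))) <= 2 * INR (fib (S k)))
 by (change 2 with (INR 2); rewrite <- mult_INR; apply le_INR; lia).
set (x := INR (fib (S k))) in *. set (y := INR (fib (S (S k)))) in *.
destruct HV as [[Hr ->]|[Hr ->]].
(* The ratio is [F_K / F_(K+1)] in the first case and [F_K / F_(K-1)] in the second. *)
- assert (HP1 : solP th m = 1%C).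
  { assert (H : exists i, (5 * i = Z.of_nat m - 1 \/ 5 * i = - Z.of_nat m - 1)%Z).
    { destruct Hr as [Hr|Hr]; [exists (Z.of_nat m / 5)%Z|exists (- (Z.of_nat m / 5) - 1)%Z];
      zdiv. }
    destruct H as [i Hi]. exact (solP_value c m i Hm Hg Hi). }
  pose proof (solQ_value_pos c m j Hm Hg Hr Hj) as HQ1. fold th in HQ1.
  rewrite HP1, Cmult_1_r, <- RtoC_plus.
  assert (HQm : Cmod (solQ th m) = 1).
  { transitivity (Cmod (cis (th / 5) * solQ th m)).
    - rewrite Cmod_mult, Cmod_cis. ring.
    - rewrite HQ1. apply Cmod_cis. }
  rewrite Cmod_mult, HQm, !Cmod_R, !Rabs_pos_eq by lra.
  split; [lra|]. split; [lra|].
  replace (cis (th / 5) * (y * solQ th m / (y + x)%R) - cis (2 * PI * IZR j / 5) / phi)%C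
   with ((y / (y + x) - / phi)%R * (cis (2 * PI * IZR j / 5)))%C.
  2:{ rewrite <- HQ1, RtoC_minus, RtoC_div, RtoC_inv, !RtoC_plus by lra. field.
      rewrite <- RtoC_plus. split; apply RtoC_neq_0; lra. }
  rewrite Cmod_mult, Cmod_cis, Rmult_1_r, Cmod_R.
  pose proof (fib_phi_bound (S (S k))) as Hb. rewrite (fib_SS (S k)), plus_INR in Hb.
  fold x y in Hb.
  replace (y / (y + x) - / phi) with ((phi * y - (y + x)) / (phi * (y + x))) by (field; lra).
  unfold Rdiv. rewrite Rabs_mult, Rabs_inv, (Rabs_pos_eq (phi * (y + x))) by nra.
  transitivity (1 * / (phi * (y + x))).
  + apply Rmult_le_compat_r; [|exact Hb]. left. apply Rinv_0_lt_compat. nra.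
  + rewrite Rmult_1_l. apply Rinv_le_contravar; nra.
- assert (HP1 : solP th m = 0%C).
  { apply solP_at_period_0; [now apply rat_angle_primitive|exact Hm|].
    destruct Hr as [Hr|Hr]; [left|right]; apply Nat2Z.inj; now rewrite Nat2Z.inj_mod. }
  pose proof (solQ_value_neg c m j Hm Hg Hr Hj) as HQ1. fold th in HQ1.
  rewrite HP1, Cmult_0_r, Cplus_0_l.
  assert (HQm : Cmod (solQ th m) = 1).
  { transitivity (Cmod (cis (th / 5) * solQ th m)).
    - rewrite Cmod_mult, Cmod_cis. ring.
    - rewrite HQ1, Cmod_opp. apply Cmod_cis. }
  rewrite Cmod_mult, HQm, !Cmod_R, !Rabs_pos_eq by lra.
  split; [lra|]. split; [lra|].
  replace (cis (th / 5) * (y * solQ th m / x) - - phi * cis (2 * PI * IZR j / 5))%C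
   with ((phi - y / x)%R * (cis (2 * PI * IZR j / 5)))%C.
  2:{ transitivity ((y / x)%C * (cis (th / 5) * solQ th m) - - phi * cis (2 * PI * IZR j / 5))%C.
      - rewrite HQ1, RtoC_minus, RtoC_div by lra. ring.
      - field. apply RtoC_neq_0; lra. }
  rewrite Cmod_mult, Cmod_cis, Rmult_1_r, Cmod_R.
  pose proof (fib_phi_bound (S k)) as Hb. fold x y in Hb.
  replace (phi - y / x) with ((phi * x - y) / x) by (field; lra).
  unfold Rdiv. rewrite Rabs_mult, Rabs_inv, (Rabs_pos_eq x) by lra.
  transitivity (1 * / x).
  + apply Rmult_le_compat_r; [|exact Hb]. left. apply Rinv_0_lt_compat. lra.
  + rewrite Rmult_1_l. apply Rinv_le_contravar; lra.
Qed.

(** * Regular continued fractions *)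

Fixpoint cnum (b : nat -> nat) (n : nat) : nat :=
  match n with
  | O => b 0
  | S m => match m with O => b 1 * b 0 + 1 | S k => b n * cnum b m + cnum b k end
  end%nat.

Fixpoint cden (b : nat -> nat) (n : nat) : nat :=
  match n with
  | O => 1
  | S m => match m with O => b 1 | S k => b n * cden b m + cden b k end
  end%nat.

Lemma cnum_SS b n : cnum b (S (S n)) = (b (S (S n)) * cnum b (S n) + cnum b n)%nat.
Proof. reflexivity. Qed.

Lemma cden_SS b n : cden b (S (S n)) = (b (S (S n)) * cden b (S n) + cden b n)%nat.
Proof. reflexivity. Qed.

Lemma cden_shift b n : cden b (S n) = cnum (fun i => b (S i)) n.
Proof.
induction n as [| |n IH0 IH1] using nat_ind2.
- reflexivity.
- simpl. ring.
- now rewrite cden_SS, IH0, IH1, cnum_SS.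
Qed.

(** Links the recurrence at the tail of a continued fraction to [cf_convergent], which
    recurs at the head. *)
Lemma cnum_shift b n :
  cnum b (S n) = (b 0 * cnum (fun i => b (S i)) n + cden (fun i => b (S i)) n)%nat.
Proof.
induction n as [| |n IH0 IH1] using nat_ind2.
- simpl. ring.
- simpl. ring.
- rewrite cnum_SS, IH0, IH1, (cnum_SS _ n), (cden_SS _ n). ring.
Qed.

Lemma cden_pos b n : (forall i, 1 <= b (S i))%nat -> (1 <= cden b n)%nat.
Proof.
intros Hb. induction n as [| |n IH0 IH1] using nat_ind2.
- simpl. lia.
- simpl. apply Hb.
- rewrite cden_SS. lia.
Qed.

Lemma cf_convergent_frac b n : (forall i, 1 <= b (S i))%nat ->
  cf_convergent b n = INR (cnum b n) / INR (cden b n).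
Proof.
revert b. induction n as [|n IH]; intros b Hb.
- simpl. field.
- change (cf_convergent b (S n)) with (INR (b 0%nat) + / cf_convergent (fun i => b (S i)) n).
  rewrite IH by (intros i; apply Hb).
  rewrite cnum_shift, <- cden_shift, plus_INR, mult_INR.
  assert (H1 : INR (cden b (S n)) <> 0)
   by (apply not_0_INR; pose proof (cden_pos b (S n) Hb); lia).
  assert (H2 : INR (cden (fun i => b (S i)) n) <> 0)
   by (apply not_0_INR; pose proof (cden_pos (fun i => b (S i)) n (fun i => Hb (S i))); lia).
  field. tauto.
Qed.

Lemma cf_det b n :
  (Z.of_nat (cnum b (S n)) * Z.of_nat (cden b n)
   - Z.of_nat (cnum b n) * Z.of_nat (cden b (S n)) = (-1) ^ Z.of_nat n)%Z.
Proof.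
induction n as [|n IH].
- simpl. lia.
- rewrite cnum_SS, cden_SS, !Nat2Z.inj_add, !Nat2Z.inj_mul, Nat2Z.inj_succ, Z.pow_succ_r by lia.
  rewrite <- IH. ring.
Qed.

Lemma pow_m1_cases n : ((-1) ^ Z.of_nat n = 1 \/ (-1) ^ Z.of_nat n = -1)%Z.
Proof.
induction n as [|n IH]; [now left|].
rewrite Nat2Z.inj_succ, Z.pow_succ_r by lia. lia.
Qed.

Lemma cnum_cden_coprime b n : rel_prime (Z.of_nat (cnum b n)) (Z.of_nat (cden b n)).
Proof.
apply bezout_rel_prime. pose proof (cf_det b n) as H.
destruct (pow_m1_cases n) as [E|E]; rewrite E in H.
- apply (Bezout_intro _ _ _ (- Z.of_nat (cden b (S n))) (Z.of_nat (cnum b (S n)))). lia.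
- apply (Bezout_intro _ _ _ (Z.of_nat (cden b (S n))) (- Z.of_nat (cnum b (S n)))). lia.
Qed.

Lemma cden_growth b n : (forall i, 2 <= b (S i))%nat -> (2 * cden b n <= cden b (S n))%nat.
Proof.
intros Hb. destruct n as [|n]; [simpl; specialize (Hb 0%nat); lia|].
rewrite cden_SS. specialize (Hb (S n)). nia.
Qed.

Lemma cf_step b n : (forall i, 2 <= b (S i))%nat ->
  Rabs (cf_convergent b (S n) - cf_convergent b n) = / (INR (cden b n) * INR (cden b (S n))).
Proof.
intros Hb. assert (Hb1 : forall i, (1 <= b (S i))%nat) by (intros i; specialize (Hb i); lia).
rewrite !cf_convergent_frac by exact Hb1.
assert (H0 : 0 < INR (cden b n)) by (apply (lt_INR 0); pose proof (cden_pos b n Hb1); lia).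
assert (H1 : 0 < INR (cden b (S n))) by (apply (lt_INR 0); pose proof (cden_pos b (S n) Hb1); lia).
pose proof (cf_det b n) as H. apply (f_equal IZR) in H.
rewrite minus_IZR, !mult_IZR, <- !INR_IZR_INZ in H.
replace (INR (cnum b (S n)) / INR (cden b (S n)) - INR (cnum b n) / INR (cden b n))
 with (IZR ((-1) ^ Z.of_nat n) * / (INR (cden b n) * INR (cden b (S n))))
 by (rewrite <- H; field; lra).
rewrite Rabs_mult, Rabs_inv, (Rabs_pos_eq (_ * _)) by nra.
replace (Rabs (IZR ((-1) ^ Z.of_nat n))) with 1; [ring|].
destruct (pow_m1_cases n) as [E|E]; rewrite E; [rewrite Rabs_R1|rewrite Rabs_m1]; reflexivity.
Qed.

(** The denominators at least double, so consecutive differences form a dominated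
    geometric series. *)
Lemma cf_tail b : (forall i, 2 <= b (S i))%nat -> forall k n,
  Rabs (cf_convergent b (n + k) - cf_convergent b n)
  <= 2 / (INR (cden b n) * INR (cden b (S n))).
Proof.
intros Hb. assert (Hb1 : forall i, (1 <= b (S i))%nat) by (intros i; specialize (Hb i); lia).
assert (Hpos : forall n, 0 < INR (cden b n))
 by (intros n; apply (lt_INR 0); pose proof (cden_pos b n Hb1); lia).
induction k as [|k IH]; intros n.
- rewrite Nat.add_0_r, Rminus_diag, Rabs_R0.
  apply Rlt_le, Rdiv_lt_0_compat; [lra|]. apply Rmult_lt_0_compat; apply Hpos.
- replace (n + S k)%nat with (S n + k)%nat by lia.
  replace (cf_convergent b (S n + k) - cf_convergent b n) with
   ((cf_convergent b (S n + k) - cf_convergent b (S n)) +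
    (cf_convergent b (S n) - cf_convergent b n)) by ring.
  eapply Rle_trans; [apply Rabs_triang|].
  rewrite (cf_step b n Hb). specialize (IH (S n)).
  pose proof (Hpos n) as P0. pose proof (Hpos (S n)) as P1. pose proof (Hpos (S (S n))) as P2.
  assert (G : 2 * INR (cden b n) <= INR (cden b (S (S n)))).
  { change 2 with (INR 2). rewrite <- mult_INR. apply le_INR.
    pose proof (cden_growth b n Hb). pose proof (cden_growth b (S n) Hb). lia. }
  set (x := INR (cden b n)) in *. set (y := INR (cden b (S n))) in *.
  set (z := INR (cden b (S (S n)))) in *.
  (* The bound at index [n + 1] is at most half of the bound at [n], so one more step fits. *)
  assert (2 / (y * z) <= 1 / (x * y)).
  { apply Rle_trans with (2 / (y * (2 * x))).
    - apply Rmult_le_compat_l; [lra|]. apply Rinv_le_contravar; nra.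
    - right. field. lra. }
  replace (2 / (x * y)) with (1 / (x * y) + / (x * y)) by (field; lra). lra.
Qed.

Lemma cf_approx b t n : (forall i, 2 <= b (S i))%nat -> has_cf_expansion t b ->
  Rabs (t - INR (cnum b n) / INR (cden b n)) <= 2 / (INR (cden b n) * INR (cden b (S n))).
Proof.
intros Hb Ht. assert (Hb1 : forall i, (1 <= b (S i))%nat) by (intros i; specialize (Hb i); lia).
rewrite <- cf_convergent_frac by exact Hb1.
set (v := cf_convergent b n).
assert (Hlim : is_lim_seq (fun k => Rabs (cf_convergent b (n + k) - v)) (Rabs (t - v))).
{ apply (is_lim_seq_abs _ (Finite (t - v))).
  apply is_lim_seq_minus'; [|apply is_lim_seq_const].
  apply (is_lim_seq_incr_n _ n) in Ht.
  apply is_lim_seq_ext with (2 := Ht). intros k. f_equal. lia. }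
exact (is_lim_seq_le _ _ _ _ (fun k => cf_tail b Hb k n) Hlim (is_lim_seq_const _)).
Qed.

(** * Growth of the tower *)

Open Scope nat_scope.

(* The towers must stay symbolic. *)
Local Opaque Nat.pow.

Lemma tower_mono z j : tower z j < tower (S z) j.
Proof.
induction j as [|j IH]; cbn [tower]; [lia|]. apply Nat.pow_lt_mono_r; lia.
Qed.

Lemma tower_S_16 z j : 16 * tower z (S j) <= tower (S z) (S j).
Proof.
cbn [tower]. rewrite <- Nat.pow_succ_r'. apply Nat.pow_le_mono_r; [lia|].
apply tower_mono.
Qed.

(** Raising the top of the tower by 1 multiplies level 1 and all higher levels by at least
    16, and so raises each next level to at least its 16th power; the fourth power
    suffices for the growth of the denominators. *)
Lemma tower_S_pow z j : tower z (S (S j)) ^ 4 <= tower (S z) (S (S j)).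
Proof.
change (tower z (S (S j))) with (16 ^ tower z (S j)).
change (tower (S z) (S (S j))) with (16 ^ tower (S z) (S j)).
rewrite <- Nat.pow_mul_r. apply Nat.pow_le_mono_r; [lia|].
pose proof (tower_S_16 z j). lia.
Qed.

Lemma g_S n : g (S n) = 16 ^ tower (S n) n.
Proof. reflexivity. Qed.

Lemma g_pos n : 1 <= n -> 16 <= g n.
Proof.
intros Hn. destruct n as [|n]; [lia|]. rewrite g_S.
apply Nat.le_trans with (16 ^ 1); [reflexivity|].
apply Nat.pow_le_mono_r; [lia|].
destruct n as [|n]; cbn [tower]; [lia|]. apply Nat.neq_0_lt_0, Nat.pow_nonzero. lia.
Qed.

Lemma g_growth n : 2 * (g n * g n) <= g (S n).
Proof.
rewrite g_S. apply Nat.le_trans with (16 ^ g n).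
- (* [16^g = (2^g)^4], and [2^g > g] *)
  change 16 with (4 * 4) at 1. rewrite Nat.pow_mul_l.
  change 4 with (2 * 2). rewrite Nat.pow_mul_l.
  pose proof (Nat.pow_gt_lin_r 2 (g n) ltac:(lia)) as H.
  set (x := 2 ^ g n) in *. set (y := g n) in *.
  assert (H2 : 2 * y <= x * x) by nia.
  apply Nat.le_trans with ((2 * y) * (2 * y)); [nia|now apply Nat.mul_le_mono].
- apply Nat.pow_le_mono_r; [lia|]. apply Nat.lt_le_incl, tower_mono.
Qed.

Lemma a_le_4 n : a n <= 4.
Proof.
destruct n as [|[|[|k]]]; try (simpl; lia).
change (nth (k mod 12) a_period 0 <= 4).
pose proof (Nat.mod_upper_bound k 12 ltac:(lia)). destruct (k mod 12) as [|r]; [simpl; lia|].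
do 11 (destruct r as [|r]; [simpl; lia|]). lia.
Qed.

Lemma pq_ge_2 i : 2 <= partial_quotient (S i).
Proof. unfold partial_quotient. pose proof (g_pos (S i)). lia. Qed.

Lemma cden_ge_n n : n <= cden partial_quotient n.
Proof.
induction n as [|n IH]; [lia|].
pose proof (cden_growth partial_quotient n pq_ge_2).
assert (1 <= cden partial_quotient n) by (apply cden_pos; intros i; pose proof (pq_ge_2 i); lia).
lia.
Qed.

(** [d_n] is roughly [g_n ... g_1], and [g_n] alone dominates the other factors. *)
Lemma cden_le_g n : 1 <= n -> cden partial_quotient n <= g n * g n.
Proof.
intros Hn. destruct n as [|n]; [lia|]. clear Hn.
induction n as [|n IH].
- change (cden partial_quotient 1) with (g 1 + 0). pose proof (g_pos 1). nia.
- rewrite cden_SS. unfold partial_quotient at 1.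
  pose proof (cden_growth partial_quotient n pq_ge_2).
  pose proof (g_growth (S n)). pose proof (a_le_4 (S (S n))).
  pose proof (g_pos (S (S n))).
  set (x := g (S n)) in *. set (y := g (S (S n))) in *.
  set (d := cden partial_quotient (S n)) in *. set (e := cden partial_quotient n) in *.
  apply Nat.le_trans with ((y + 5) * d); [nia|].
  apply Nat.le_trans with ((2 * y) * (x * x)); [apply Nat.mul_le_mono; lia|]. nia.
Qed.

(** [d_(n+1) >= g_(n+1) = 16^(T_n(n+1))], and [T_n(n+1) >= g_n^4 >= d_n^2]. *)
Lemma cden_sq_le n : 2 <= n ->
  16 ^ (cden partial_quotient n * cden partial_quotient n) <= cden partial_quotient (S n).
Proof.
intros Hn. apply Nat.le_trans with (g (S n)).
- rewrite g_S. apply Nat.pow_le_mono_r; [lia|].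
  destruct n as [|[|n]]; try lia.
  apply Nat.le_trans with (2 := tower_S_pow (S (S n)) n).
  change (tower (S (S n)) (S (S n))) with (g (S (S n))).
  pose proof (cden_le_g (S (S n)) ltac:(lia)).
  apply Nat.le_trans with ((g (S (S n)) * g (S (S n))) * (g (S (S n)) * g (S (S n)))).
  + now apply Nat.mul_le_mono.
  + rewrite !Nat.pow_succ_r', Nat.pow_0_r. lia.
- destruct n as [|n]; [lia|]. rewrite cden_SS. unfold partial_quotient at 1.
  assert (1 <= cden partial_quotient (S n))
   by (apply cden_pos; intros i; pose proof (pq_ge_2 i); lia).
  nia.
Qed.

(** * Residues modulo 5 *)

Definition residue_step (b : nat) (r : (nat * nat) * (nat * nat)) :=
  let '((p, p'), (q, q')) := r in ((p', (b * p' + p) mod 5), (q', (b * q' + q) mod 5)).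

(** [(c_n, c_(n+1))] and [(d_n, d_(n+1))] modulo 5, computed from the [a_i] alone since
    every [g_i] is 1 modulo 5. *)
Fixpoint residues (n : nat) : (nat * nat) * (nat * nat) :=
  match n with
  | O => ((0, 1), (1, 1))
  | S m => residue_step (1 + a (S (S m))) (residues m)
  end.

Lemma residues_S m : residues (S m) = residue_step (1 + a (S (S m))) (residues m).
Proof. reflexivity. Qed.

Lemma pow16_mod5 n : 16 ^ n mod 5 = 1.
Proof.
induction n as [|n IH]; [reflexivity|].
rewrite Nat.pow_succ_r', Nat.Div0.mul_mod, IH. reflexivity.
Qed.

Lemma linear_mod5 m u v x y : u mod 5 = x mod 5 -> v mod 5 = y mod 5 ->
  (partial_quotient (S m) * u + v) mod 5 = ((1 + a (S m)) * x + y) mod 5.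
Proof.
intros Hu Hv. change (partial_quotient (S m)) with (g (S m) + a (S m)). rewrite g_S.
rewrite Nat.Div0.add_mod, Nat.Div0.mul_mod, Hu, Hv, (Nat.Div0.add_mod (16 ^ _)), pow16_mod5.
rewrite (Nat.Div0.add_mod _ y), (Nat.Div0.mul_mod _ x).
rewrite (Nat.Div0.add_mod 1 (a (S m))). reflexivity.
Qed.

Lemma residues_spec n :
  residues n = ((cnum partial_quotient n mod 5, cnum partial_quotient (S n) mod 5),
                (cden partial_quotient n mod 5, cden partial_quotient (S n) mod 5)).
Proof.
induction n as [|n IH].
- reflexivity.
- rewrite residues_S, IH. unfold residue_step. rewrite cnum_SS, cden_SS.
  apply f_equal2; apply f_equal2; try reflexivity; symmetry; apply linear_mod5;
   now rewrite Nat.Div0.mod_mod.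
Qed.

Lemma a_periodic n : 3 <= n -> Defs.a (n + 12) = Defs.a n.
Proof.
intros Hn. destruct n as [|[|[|k]]]; try lia.
change (S (S (S k)) + 12) with (S (S (S (k + 12)))).
unfold a. f_equal. rewrite <- (Nat.mul_1_l 12) at 1. apply Nat.Div0.mod_add.
Qed.

(** The [a_i] have period 12 from [i = 3] on, and the state at [n = 1]
    recurs at [n = 13]. *)
Lemma residues_period n : 1 <= n -> residues (n + 12) = residues n.
Proof.
intros Hn. induction n as [|n IH]; [lia|].
destruct n as [|n]; [vm_compute; reflexivity|].
change (S (S n) + 12) with (S (S n + 12)).
rewrite (residues_S (S n)), (residues_S (S n + 12)), IH by lia.
change (S (S (S n + 12))) with (S (S (S n)) + 12). now rewrite a_periodic by lia.
Qed.

Lemma residues_periodic n k : 1 <= n -> residues (n + 12 * k) = residues n.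
Proof.
intros Hn. induction k as [|k IH]; [f_equal; lia|].
rewrite <- IH, <- (residues_period (n + 12 * k)) by lia. f_equal. lia.
Qed.

Close Scope nat_scope.

(** * Perturbation *)

Lemma cos_lipschitz u v : Rabs (cos u - cos v) <= Rabs (u - v).
Proof.
destruct (MVT_gen cos v u (fun x => - sin x)) as [c [_ Hc]].
- intros x _. auto_derive; [exact I|ring].
- intros x _. apply continuity_cos.
- rewrite Hc, Rabs_mult, Rabs_Ropp. rewrite <- (Rmult_1_l (Rabs (u - v))) at 2.
  apply Rmult_le_compat_r; [apply Rabs_pos|]. apply Rabs_le, SIN_bound.
Qed.

Lemma sin_lipschitz u v : Rabs (sin u - sin v) <= Rabs (u - v).
Proof.
rewrite !sin_cos.
replace (- cos (PI / 2 + u) - - cos (PI / 2 + v)) with (- (cos (PI / 2 + u) - cos (PI / 2 + v)))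
 by ring.
rewrite Rabs_Ropp. replace (u - v) with ((PI / 2 + u) - (PI / 2 + v)) by ring.
apply cos_lipschitz.
Qed.

Lemma Cmod_le_sum (z : C) : Cmod z <= Rabs (fst z) + Rabs (snd z).
Proof.
destruct z as [x y]. simpl.
replace (x, y) with (RtoC x + Ci * RtoC y)%C.
- eapply Rle_trans; [apply Cmod_triangle|].
  rewrite Cmod_mult, Cmod_Ci, !Cmod_R. lra.
- unfold Ci, RtoC, Cmult, Cplus; simpl. f_equal; ring.
Qed.

Lemma cis_lipschitz u v : Cmod (cis u - cis v) <= 2 * Rabs (u - v).
Proof.
eapply Rle_trans; [apply Cmod_le_sum|]. simpl.
pose proof (cos_lipschitz u v). pose proof (sin_lipschitz u v).
unfold Rminus in *. lra.
Qed.

Lemma le_pow2 n : INR n + 1 <= 2 ^ n.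
Proof.
induction n as [|n IH]; [simpl; lra|]. rewrite S_INR. simpl pow. pose proof (pos_INR n). lra.
Qed.

Lemma pow4 n : 4 ^ n = 2 ^ n * 2 ^ n.
Proof. rewrite <- Rpow_mult_distr. now replace (2 * 2) with 4 by ring. Qed.

Lemma solves_bound th u : solves th u -> Cmod (u 0%nat) <= 1 -> Cmod (u 1%nat) <= 1 ->
  forall n, Cmod (u n) <= 2 ^ n.
Proof.
intros Hu H0 H1 n. induction n as [| |n IH0 IH1] using nat_ind2; [simpl; lra|simpl; lra|].
rewrite Hu. eapply Rle_trans; [apply Cmod_triangle|].
rewrite Cmod_mult, Cmod_xpow. simpl pow in *. pose proof (le_pow2 n). pose proof (pos_INR n). lra.
Qed.

(** Solutions grow at most like [2^n], and each step adds at most [2 (n + 1)] times the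
    angle difference times [2^n]; the crude rate [4^n] absorbs both. *)
Lemma solves_perturb th1 th2 u v : solves th1 u -> solves th2 v ->
  u 0%nat = v 0%nat -> u 1%nat = v 1%nat ->
  Cmod (u 0%nat) <= 1 -> Cmod (u 1%nat) <= 1 ->
  forall n, Cmod (u n - v n) <= 4 ^ n * (2 * Rabs (th1 - th2)).
Proof.
intros Hu Hv E0 E1 H0 H1 n.
pose proof (Rabs_pos (th1 - th2)) as Hd. set (d := Rabs (th1 - th2)) in *.
induction n as [| |n IH0 IH1] using nat_ind2.
- replace (u 0%nat - v 0%nat)%C with (RtoC 0) by (rewrite E0; ring). rewrite Cmod_0. simpl; lra.
- replace (u 1%nat - v 1%nat)%C with (RtoC 0) by (rewrite E1; ring). rewrite Cmod_0. simpl; lra.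
- rewrite Hu, Hv. set (k := Z.of_nat (S n)).
  replace (u (S n) + xpow th1 k * u n - (v (S n) + xpow th2 k * v n))%C
   with ((u (S n) - v (S n))
     + ((xpow th1 k - xpow th2 k) * u n + xpow th2 k * (u n - v n)))%C by ring.
  eapply Rle_trans; [apply Cmod_triangle|].
  assert (H : Cmod ((xpow th1 k - xpow th2 k) * u n + xpow th2 k * (u n - v n))
    <= 2 ^ n * (2 * d) * 2 ^ n + 4 ^ n * (2 * d)).
  { eapply Rle_trans; [apply Cmod_triangle|]. rewrite !Cmod_mult, Cmod_xpow, Rmult_1_l.
    apply Rplus_le_compat; [|exact IH0].
    apply Rmult_le_compat; try apply Cmod_ge_0; [|now apply solves_bound with th1].
    unfold xpow. eapply Rle_trans; [apply cis_lipschitz|].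
    rewrite <- Rmult_minus_distr_r, Rabs_mult. fold d.
    rewrite (Rabs_pos_eq (IZR k)) by (apply IZR_le; lia).
    unfold k. rewrite <- INR_IZR_INZ, S_INR. pose proof (le_pow2 n). nra. }
  pose proof (pow_le 4 n ltac:(lra)) as H4.
  replace (2 ^ n * (2 * d) * 2 ^ n) with (4 ^ n * (2 * d)) in H by (rewrite pow4; ring).
  simpl pow in *. assert (0 <= 4 ^ n * d) by (apply Rmult_le_pos; lra). nra.
Qed.

Lemma ratio_perturb (p q p' q' : C) (eta : R) :
  1 <= Cmod p -> Cmod q <= 2 * Cmod p -> Cmod (p' - p) <= eta -> Cmod (q' - q) <= eta ->
  eta <= / 2 ->
  p' <> 0%C /\ Cmod (q' / p' - q / p) <= 6 * eta.
Proof.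
intros Hp Hq Hdp Hdq He.
assert (Heta : 0 <= eta) by (eapply Rle_trans; [apply Cmod_ge_0|exact Hdp]).
assert (Hp' : / 2 <= Cmod p').
{ pose proof (Cmod_triangle p' (- (p' - p))%C) as H.
  replace (p' + - (p' - p))%C with p in H by ring. rewrite Cmod_opp in H. lra. }
assert (N : p <> 0%C) by (intros ->; rewrite Cmod_0 in Hp; lra).
assert (N' : p' <> 0%C) by (intros ->; rewrite Cmod_0 in Hp'; lra).
split; [exact N'|].
replace (q' / p' - q / p)%C with (((q' - q) * p - q * (p' - p)) / (p' * p))%C by (field; tauto).
rewrite Cmod_div by (now apply Cmult_neq_0). rewrite Cmod_mult.
assert (H : Cmod ((q' - q) * p - q * (p' - p)) <= 3 * eta * Cmod p).
{ unfold Cminus at 1. eapply Rle_trans; [apply Cmod_triangle|].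
  rewrite Cmod_opp, !Cmod_mult. pose proof (Cmod_ge_0 q). nra. }
apply Rmult_le_reg_r with (Cmod p' * Cmod p); [nra|].
unfold Rdiv. rewrite Rmult_assoc, Rinv_l by nra.
assert (0 <= (eta * Cmod p) * (Cmod p' - / 2)) by (apply Rmult_le_pos; [nra|lra]). nra.
Qed.

(** * Convergents near a root of unity *)

Lemma Cinv_0 : (/ 0)%C = 0%C.
Proof. unfold Cinv, RtoC. simpl. f_equal; unfold Rdiv; ring. Qed.

(** [N = m^2 - 1] is long enough for the convergents at the root of unity to settle and
    short enough for the perturbation to be negligible. *)
Lemma convergent_near t c m (j : Z) V N : (64 <= m)%nat ->
  rel_prime (Z.of_nat c) (Z.of_nat m) ->
  ((j * Z.of_nat m) mod 5 = Z.of_nat c mod 5)%Z ->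
  root_value m j V ->
  S N = (m * m)%nat ->
  Rabs (t - INR c / INR m) <= 2 / 16 ^ (m * m) ->
  Cmod (R_convergent t N - V) <= 400 / INR m.
Proof.
intros Hm Hg Hj HV HN Ht.
destruct (root_convergent c m j m V ltac:(lia) ltac:(lia) Hg Hj HV) as (HP & HQ & HL).
set (th := rat_angle c m) in *.
assert (Hmpos : 64 <= INR m) by (replace 64 with (INR 64) by (simpl; lra); now apply le_INR).
set (ty := 2 * PI * t).
(* [eta] bounds the change of [P_N] and [Q_N] between the two points:
   [4^(m^2) * 2 * 2 pi * 2 / 16^(m^2) = 8 pi / 4^(m^2) <= 32 / m]. *)
set (eta := 32 / INR m).
assert (He : eta <= / 2).
{ unfold eta. apply Rmult_le_reg_r with (INR m); [lra|].
  unfold Rdiv. rewrite Rmult_assoc, Rinv_l by lra. lra. }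
assert (Hd : 4 ^ (m * m) * (2 * Rabs (ty - th)) <= eta).
{ unfold ty, th, rat_angle. rewrite <- Rmult_minus_distr_l, Rabs_mult, (Rabs_pos_eq (2 * PI))
   by (pose proof PI_RGT_0; lra).
  replace 16 with (4 * 4) in Ht by ring. rewrite Rpow_mult_distr in Ht.
  assert (H4 : INR m <= 4 ^ (m * m)).
  { apply Rle_trans with (2 ^ m); [pose proof (le_pow2 m); lra|].
    apply Rle_trans with (4 ^ m); [apply pow_incr; lra|]. apply Rle_pow; [lra|nia]. }
  set (p := 4 ^ (m * m)) in *. set (d := Rabs (t - INR c / INR m)) in *.
  apply Rle_trans with (p * (2 * (2 * PI * (2 / (p * p))))).
  - apply Rmult_le_compat_l; [lra|]. apply Rmult_le_compat_l; [lra|].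
    apply Rmult_le_compat_l; [pose proof PI_RGT_0; lra|exact Ht].
  - replace (p * (2 * (2 * PI * (2 / (p * p))))) with (8 * PI / p) by (field; lra).
    apply Rle_trans with (32 / p).
    + apply Rmult_le_compat_r; [left; apply Rinv_0_lt_compat; lra|]. pose proof PI_4. lra.
    + apply Rmult_le_compat_l; [lra|]. apply Rinv_le_contravar; lra. }
assert (HdP : Cmod (solP ty (m * m) - solP th (m * m)) <= eta).
{ eapply Rle_trans; [|exact Hd].
  apply solves_perturb; auto using solP_solves; change (Cmod 1 <= 1); rewrite Cmod_1; lra. }
assert (HdQ : Cmod (solQ ty (m * m) - solQ th (m * m)) <= eta).
{ eapply Rle_trans; [|exact Hd].
  apply solves_perturb; auto using solQ_solves; simpl; rewrite ?Cmod_1, ?Cmod_0; lra. }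
destruct (ratio_perturb _ _ _ _ eta HP HQ HdP HdQ He) as [HN0 Hr].
assert (HR : R_convergent t N = (cis (ty / 5) * (solQ ty (m * m) / solP ty (m * m)))%C).
{ unfold R_convergent, K_convergent. rewrite P_solP, Q_solQ, HN. fold ty.
  destruct (Ceq_dec (solQ ty (m * m)) 0) as [E|HQ0].
  - (* If [Q_N] vanishes, both sides are 0 by the convention [/ 0 = 0]. *)
    rewrite E. unfold Cdiv. rewrite Cinv_0, !Cmult_0_r, Cinv_0. ring.
  - field. auto. }
assert (Hc : Cmod (cis (ty / 5) - cis (th / 5)) <= eta).
{ eapply Rle_trans; [apply cis_lipschitz|].
  replace (ty / 5 - th / 5) with (/ 5 * (ty - th)) by field.
  rewrite Rabs_mult, (Rabs_pos_eq (/ 5)) by lra.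
  eapply Rle_trans; [|exact Hd].
  pose proof (Rabs_pos (ty - th)). pose proof (pow_R1_Rle 4 (m * m) ltac:(lra)). nra. }
assert (Hp0 : solP th (m * m) <> 0%C) by (intros E; rewrite E, Cmod_0 in HP; lra).
assert (Hq : Cmod (solQ ty (m * m) / solP ty (m * m)) <= 5).
{ replace (solQ ty (m * m) / solP ty (m * m))%C with
   (solQ th (m * m) / solP th (m * m)
    + (solQ ty (m * m) / solP ty (m * m) - solQ th (m * m) / solP th (m * m)))%C by ring.
  eapply Rle_trans; [apply Cmod_triangle|].
  assert (Cmod (solQ th (m * m) / solP th (m * m)) <= 2).
  { rewrite Cmod_div by exact Hp0. apply Rmult_le_reg_r with (Cmod (solP th (m * m))); [lra|].
    unfold Rdiv. rewrite Rmult_assoc, Rinv_l by lra. lra. }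
  lra. }
assert (Hm2 : / INR (m - 2) <= 48 / INR m).
{ rewrite minus_INR by lia. simpl (INR 2).
  apply Rle_trans with (/ (INR m / 48)).
  - apply Rinv_le_contravar; lra.
  - right. field. lra. }
rewrite HR.
(* Three errors: the fifth root, the perturbed ratio, and the Fibonacci ratio. *)
set (A := (solQ ty (m * m) / solP ty (m * m))%C) in *.
set (B := (solQ th (m * m) / solP th (m * m))%C) in *.
replace (cis (ty / 5) * A - V)%C with
 ((cis (ty / 5) - cis (th / 5)) * A + (cis (th / 5) * (A - B) + (cis (th / 5) * B - V)))%C by ring.
eapply Rle_trans; [apply Cmod_triangle|].
pose proof (Cmod_triangle (cis (th / 5) * (A - B)) (cis (th / 5) * B - V)) as H3.
rewrite !Cmod_mult in *. rewrite Cmod_cis in H3.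
assert (Cmod (cis (ty / 5) - cis (th / 5)) * Cmod A <= eta * 5)
 by (apply Rmult_le_compat; auto using Cmod_ge_0).
replace (400 / INR m) with (eta * 5 + (6 * eta + 48 / INR m)) by (unfold eta; field; lra).
lra.
Qed.

(** * The ten limits *)

Lemma filterlim_C_of_Cmod (f : nat -> C) (l : C) :
  (forall eps : posreal, exists n0, forall n, (n0 <= n)%nat -> Cmod (f n - l) < eps) ->
  filterlim f eventually (locally l).
Proof.
intros H. apply filterlim_locally. intros eps. destruct (H eps) as [n0 Hn].
exists n0. intros n Hle. apply C_NormedModule_mixin_compat1. exact (Hn n Hle).
Qed.

(** A position [n] modulo 12, between 2 and 13, at which the residues of [(c_n, d_n)]
    produce the value [R_j]; the entry at 0 is a filler. *)
Definition residue_index (j : nat) : nat :=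
  nth j (0 :: 10 :: 6 :: 7 :: 8 :: 9 :: 13 :: 2 :: 3 :: 4 :: 5 :: nil)%nat 0%nat.

Lemma residue_table j : (1 <= j <= 10)%nat ->
  let '((c, _), (d, _)) := residues (residue_index j) in
  ((j * d) mod 5 = c /\ if j <=? 5 then d = 2 \/ d = 3 else d = 1 \/ d = 4)%nat.
Proof.
intros Hj. do 11 (destruct j as [|j]; [vm_compute; auto; lia|]). lia.
Qed.

Theorem corollary3 (t : R) (ht : has_cf_expansion t partial_quotient)
  (j : nat) (hj : (1 <= j <= 10)%nat) :
  exists u : nat -> nat,
    (forall k : nat, (u k < u (S k))%nat) /\
    filterlim (fun k : nat => R_convergent t (u k)) eventually
      (locally (R_value j)).
Proof.
set (q := cden partial_quotient).
(* The shift by 6 periods makes [n >= 74], so that [q n >= n] exceeds 64. *)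
set (n_ := fun k => (residue_index j + 12 * (k + 6))%nat).
assert (Hpos : forall n, (1 <= q n)%nat).
{ intros n. apply cden_pos. intros i. pose proof (pq_ge_2 i). lia. }
assert (Hgrow : forall n d, (q n <= q (n + d))%nat).
{ intros n d. induction d as [|d IH]; [now rewrite Nat.add_0_r|].
  rewrite Nat.add_succ_r.
  pose proof (cden_growth partial_quotient (n + d) pq_ge_2) as H. fold q in H. lia. }
exists (fun k => (q (n_ k) * q (n_ k) - 1)%nat). split.
- intros k. assert (H : (q (n_ k) < q (n_ (S k)))%nat).
  { replace (n_ (S k)) with (S (n_ k) + 11)%nat by (unfold n_; lia).
    pose proof (Hgrow (S (n_ k)) 11%nat).
    pose proof (cden_growth partial_quotient (n_ k) pq_ge_2). fold q in H0.
    specialize (Hpos (n_ k)). lia. }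
  specialize (Hpos (n_ k)). nia.
- assert (Hidx : (2 <= residue_index j)%nat).
  { do 11 (destruct j as [|j]; [unfold residue_index; simpl; lia|]). lia. }
  assert (Hbound : forall k, Cmod (R_convergent t (q (n_ k) * q (n_ k) - 1) - R_value j)
      <= 400 / INR (q (n_ k))).
  { intros k. set (n := n_ k).
    assert (Hn : (72 <= n)%nat) by (unfold n, n_; lia).
    pose proof (cden_ge_n n) as Hqn. fold q in Hqn.
    pose proof (residues_spec n) as Hres.
    unfold n, n_ in Hres. rewrite residues_periodic in Hres by lia. fold (n_ k) n q in Hres.
    pose proof (residue_table j hj) as Htab. rewrite Hres in Htab. destruct Htab as [Hc Hd].
    apply (convergent_near t (cnum partial_quotient n) (q n) (Z.of_nat j)).
    - lia.
    - apply cnum_cden_coprime.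
    - rewrite <- Nat2Z.inj_mul. change 5%Z with (Z.of_nat 5). rewrite <- !Nat2Z.inj_mod.
      f_equal. rewrite <- Hc. now rewrite Nat.Div0.mul_mod_idemp_r.
    - unfold R_value, root_value. rewrite <- INR_IZR_INZ. change 5%Z with (Z.of_nat 5).
      rewrite <- !Nat2Z.inj_mod.
      destruct (j <=? 5)%nat; [right|left]; (split; [|reflexivity]);
       destruct Hd as [-> | ->]; [left|right|left|right]; reflexivity.
    - specialize (Hpos n). nia.
    - eapply Rle_trans; [exact (cf_approx _ t n pq_ge_2 ht)|]. fold q.
      assert (1 <= INR (q n)) by (apply (le_INR 1); lia).
      assert (16 ^ (q n * q n) <= INR (q (S n))).
      { replace 16 with (INR 16) by (simpl; lra). rewrite <- pow_INR.
        apply le_INR, cden_sq_le. lia. }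
      pose proof (pow_lt 16 (q n * q n) ltac:(lra)).
      apply Rmult_le_compat_l; [lra|]. apply Rinv_le_contravar; nra. }
  apply filterlim_C_of_Cmod. intros eps.
  destruct (nfloor_ex (400 / eps)) as [n0 Hn0].
  { apply Rlt_le, Rdiv_lt_0_compat; [lra|apply cond_pos]. }
  exists (S n0). intros k Hk. eapply Rle_lt_trans; [apply Hbound|].
  assert (H : INR (S n0) <= INR (q (n_ k))).
  { apply le_INR. pose proof (cden_ge_n (n_ k)). fold q in H. unfold n_ in *. lia. }
  rewrite S_INR in H. destruct Hn0 as [_ Hn0]. pose proof (cond_pos eps) as He.
  pose proof (pos_INR n0).
  apply Rmult_lt_reg_r with (INR (q (n_ k)) / eps); [apply Rdiv_lt_0_compat; lra|].
  replace (400 / INR (q (n_ k)) * (INR (q (n_ k)) / eps)) with (400 / eps) by (field; lra).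
  replace (eps * (INR (q (n_ k)) / eps)) with (INR (q (n_ k))) by (field; lra). lra.
Qed.
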